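(* Let $a\neq0$, $b>0$, $c$ be real constants with $2a+b\neq 0$, $a+b>0$ and $c>0$. Let $\varphi:\Sigma\to\mathbb{H}^2\times\mathbb{R}$ be a compact graph on a domain $\Omega\subset\mathbb{H}^2$ whose boundary is contained in the slice $\mathbb{H}^2\times\{0\}$. Assume that $\Sigma$ is a W-surface ($aK_i+bK_e=c$) having positive extrinsic curvature $K_e$. Then there exists a constant $C_0$, which depends only on $K_e,a,b,c$, such that the height function $h$ satisfies $h(p)\le C_0$ for all $p\in\Sigma$.
   Context: $\mathbb{H}^2$ is the hyperbolic plane of curvature $-1$ and $\mathbb{H}^2\times\mathbb{R}$ has the product metric. $K_i$ and $K_e$ are the intrinsic (Gaussian) and extrinsic (product of principal curvatures) curvatures of $\Sigma$. A connected surface $\Sigma$ isometrically immersed in $\mathbb{H}^2\times\mathbb{R}$ is a W-surface (with constants $a\neq0$, $b>0$, $c$) if $aK_i+bK_e=c$ on $\Sigma$. The height function $h$ is the restriction to $\Sigma$ of the projection $\mathbb{H}^2\times\mathbb{R}\to\mathbb{R}$. *)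

(* Defs.v *)
From HB Require Import structures.
From mathcomp Require Import all_boot all_order all_algebra.
From mathcomp Require Import all_classical all_reals all_analysis.

Set Implicit Arguments.
Unset Strict Implicit.
Unset Printing Implicit Defensive.

Import Order.TTheory GRing.Theory Num.Theory.
Import numFieldTopology.Exports numFieldNormedType.Exports.

Local Open Scope classical_set_scope.
Local Open Scope ring_scope.

Definition partial (R : realType) (n : nat) (i : 'I_n.+1)
    (f : 'rV[R]_n.+1 -> R) : 'rV[R]_n.+1 -> R :=
  fun x => 'D_(delta_mx 0 i) f x.

Fixpoint Ck_on (R : realType) (n k : nat) (U : set 'rV[R]_n.+1)
    (f : 'rV[R]_n.+1 -> R) : Prop :=
  (forall x, U x -> {for x, continuous f}) /\
  match k with
  | 0%N => True
  | k'.+1 => forall i : 'I_n.+1,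
      (forall x, U x -> derivable f x (delta_mx 0 i)) /\
      Ck_on k' U (partial i f)
  end.

Definition smooth_on (R : realType) (n : nat) (U : set 'rV[R]_n.+1)
    (f : 'rV[R]_n.+1 -> R) : Prop :=
  forall k : nat, Ck_on k U f.

(* A metric is given by the matrix of its coefficients in global coordinates;
   [christoffel g k i j] is the symbol with upper index [k] and lower indices
   [i], [j]. *)
Definition christoffel (R : realType) (n : nat)
    (g : 'rV[R]_n.+1 -> 'M[R]_n.+1) (k i j : 'I_n.+1) (x : 'rV[R]_n.+1) : R :=
  2^-1 * \sum_l invmx (g x) k l *
    (partial i (fun y => g y j l) x + partial j (fun y => g y i l) x
     - partial l (fun y => g y i j) x).

(* The [l]-th component of R(d_i, d_j) d_k, for the convention
   R(X, Y) = [nabla_X, nabla_Y] - nabla_[X, Y]. *)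
Definition riemann (R : realType) (n : nat)
    (g : 'rV[R]_n.+1 -> 'M[R]_n.+1) (l i j k : 'I_n.+1) (x : 'rV[R]_n.+1) : R :=
  partial i (christoffel g l j k) x - partial j (christoffel g l i k) x
  + \sum_m (christoffel g l i m x * christoffel g m j k x
            - christoffel g l j m x * christoffel g m i k x).

(* <R(d_0, d_1) d_1, d_0> / det g *)
Definition gauss_curvature (R : realType) (g : 'rV[R]_2 -> 'M[R]_2)
    (x : 'rV[R]_2) : R :=
  (\sum_l g x l 0 * riemann g l 0 1 1 x) / \det (g x).

(* The upper half-plane model of the hyperbolic plane. *)
Definition H2 (R : realType) : set 'rV[R]_2 := [set p | 0 < p 0 1].

Definition H2_metric (R : realType) (p : 'rV[R]_2) : 'M[R]_2 :=
  ((p 0 1) ^- 2)%:M.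

Definition H2xR_metric (R : realType) (x : 'rV[R]_3) : 'M[R]_3 :=
  block_mx (H2_metric (lsubmx (x : 'rV[R]_(2 + 1)))) 0 0 (1%:M : 'M[R]_1).

Definition height (R : realType) (x : 'rV[R]_3) : R := x 0 2.

(* In what follows [G] is a Riemannian metric on an open subset of R^3 and [X]
   a parametrized surface in it. *)

Definition tangent (R : realType) (X : 'rV[R]_2 -> 'rV[R]_3) (i : 'I_2)
    (p : 'rV[R]_2) : 'rV[R]_3 :=
  \row_k partial i (fun q => X q 0 k) p.

Definition inner (R : realType) (n : nat) (A : 'M[R]_n) (v w : 'rV[R]_n) : R :=
  (v *m A *m w^T) 0 0.

Definition first_form (R : realType) (G : 'rV[R]_3 -> 'M[R]_3)
    (X : 'rV[R]_2 -> 'rV[R]_3) (p : 'rV[R]_2) : 'M[R]_2 :=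
  \matrix_(i, j) inner (G (X p)) (tangent X i p) (tangent X j p).

(* The coordinate cross product of the tangent vectors is a covector that
   annihilates the tangent plane (the indices [k + 1] and [k + 2] are modulo 3);
   raising its index and normalizing gives the unit normal. *)
Definition conormal (R : realType) (X : 'rV[R]_2 -> 'rV[R]_3)
    (p : 'rV[R]_2) : 'rV[R]_3 :=
  \row_(k < 3) (tangent X 0 p 0 (k + 1) * tangent X 1 p 0 (k + 2)
                - tangent X 0 p 0 (k + 2) * tangent X 1 p 0 (k + 1)).

Definition unit_normal (R : realType) (G : 'rV[R]_3 -> 'M[R]_3)
    (X : 'rV[R]_2 -> 'rV[R]_3) (p : 'rV[R]_2) : 'rV[R]_3 :=
  let N := conormal X p *m invmx (G (X p)) in
  (Num.sqrt (inner (G (X p)) N N))^-1 *: N.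

(* The covariant derivative, in the ambient space, of the [j]-th tangent
   vector along the [i]-th one. *)
Definition cov_tangent (R : realType) (G : 'rV[R]_3 -> 'M[R]_3)
    (X : 'rV[R]_2 -> 'rV[R]_3) (i j : 'I_2) (p : 'rV[R]_2) : 'rV[R]_3 :=
  \row_k (partial i (fun q => tangent X j q 0 k) p
          + \sum_l \sum_m christoffel G k l m (X p)
              * tangent X i p 0 l * tangent X j p 0 m).

Definition second_form (R : realType) (G : 'rV[R]_3 -> 'M[R]_3)
    (X : 'rV[R]_2 -> 'rV[R]_3) (p : 'rV[R]_2) : 'M[R]_2 :=
  \matrix_(i, j) inner (G (X p)) (cov_tangent G X i j p) (unit_normal G X p).

Definition shape_operator (R : realType) (G : 'rV[R]_3 -> 'M[R]_3)
    (X : 'rV[R]_2 -> 'rV[R]_3) (p : 'rV[R]_2) : 'M[R]_2 :=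
  invmx (first_form G X p) *m second_form G X p.

Definition intrinsic_curvature (R : realType) (G : 'rV[R]_3 -> 'M[R]_3)
    (X : 'rV[R]_2 -> 'rV[R]_3) (p : 'rV[R]_2) : R :=
  gauss_curvature (first_form G X) p.

Definition extrinsic_curvature (R : realType) (G : 'rV[R]_3 -> 'M[R]_3)
    (X : 'rV[R]_2 -> 'rV[R]_3) (p : 'rV[R]_2) : R :=
  \det (shape_operator G X p).

(* The principal curvatures are the eigenvalues of the shape operator, counted
   with multiplicity. *)
Definition principal_curvatures (R : realType) (G : 'rV[R]_3 -> 'M[R]_3)
    (X : 'rV[R]_2 -> 'rV[R]_3) (p : 'rV[R]_2) (k1 k2 : R) : Prop :=
  char_poly (shape_operator G X p) = ('X - k1%:P) * ('X - k2%:P).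

Lemma extrinsic_curvatureE (R : realType) (G : 'rV[R]_3 -> 'M[R]_3)
    (X : 'rV[R]_2 -> 'rV[R]_3) (p : 'rV[R]_2) (k1 k2 : R) :
  principal_curvatures G X p k1 k2 -> extrinsic_curvature G X p = k1 * k2.
Proof.
rewrite /principal_curvatures /extrinsic_curvature => E.
rewrite -[LHS]mul1r -(expr1n R 2) -[X in X ^+ 2]opprK sqrrN -char_poly_det E.
by rewrite -horner_coef0 !hornerE /= mulrNN.
Qed.

Definition graph_map (R : realType) (u : 'rV[R]_2 -> R) (p : 'rV[R]_2) :
    'rV[R]_3 :=
  row_mx p (u p)%:M.

Definition graph_Ki (R : realType) (u : 'rV[R]_2 -> R) : 'rV[R]_2 -> R :=
  intrinsic_curvature (@H2xR_metric R) (graph_map u).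

Definition graph_Ke (R : realType) (u : 'rV[R]_2 -> R) : 'rV[R]_2 -> R :=
  extrinsic_curvature (@H2xR_metric R) (graph_map u).

Definition domain (R : realType) (Omega : set 'rV[R]_2) : Prop :=
  [/\ Omega !=set0, open Omega, connected Omega & Omega `<=` @H2 R].

(* The closure relative to the hyperbolic plane. *)
Definition H2_closure (R : realType) (Omega : set 'rV[R]_2) : set 'rV[R]_2 :=
  closure Omega `&` @H2 R.

Definition surface (R : realType) (Omega : set 'rV[R]_2) (u : 'rV[R]_2 -> R) :
    set 'rV[R]_3 :=
  graph_map u @` H2_closure Omega.

Definition surface_boundary (R : realType) (Omega : set 'rV[R]_2)
    (u : 'rV[R]_2 -> R) : set 'rV[R]_3 :=
  graph_map u @` (H2_closure Omega `\` Omega).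

(* The surface is smooth over [Omega] and only continuous at its boundary, so
   that it may be vertical there. *)
Definition compact_graph (R : realType) (Omega : set 'rV[R]_2)
    (u : 'rV[R]_2 -> R) : Prop :=
  [/\ domain Omega,
      smooth_on Omega u,
      {within H2_closure Omega, continuous u} &
      compact (surface Omega u)].

Definition W_surface (R : realType) (a b c : R) (Omega : set 'rV[R]_2)
    (u : 'rV[R]_2 -> R) : Prop :=
  forall p, Omega p -> a * graph_Ki u p + b * graph_Ke u p = c.

(* Main.v *)
(* Write w = 1 + |grad u|^2 for the graph of u. The Gauss equation
   K_i = K_e - 1 / w turns the Weingarten relation into
   det (Hess u) = w (al w + be), with al = c / (a + b) and be = a / (a + b) < 1.
   At a highest point w = 1, hence al + be > 0, and - Hess u is positive
   definite there, hence everywhere. Suppose that u > C somewhere, where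
   C^2 = (m + 4) / m^2 and m = min (al, al + be). Then u - C / sqrt w attains an
   interior maximum, since it is at most u = 0 at the boundary, whatever the slope
   there. Tracing the Hessian of this function against the cofactor matrix of
   - Hess u, and differentiating the curvature equation once to eliminate the
   third derivatives of u, gives a positive number at the maximum point, which is
   absurd. So C bounds the height. *)
Require Import Defs.
From mathcomp Require Import all_boot all_order all_algebra.
From mathcomp Require Import all_classical all_reals all_analysis.
From mathcomp Require Import ring lra.

Set Implicit Arguments.
Unset Strict Implicit.
Unset Printing Implicit Defensive.

Import Order.TTheory GRing.Theory Num.Theory.
Import numFieldTopology.Exports numFieldNormedType.Exports.

Local Open Scope classical_set_scope.
Local Open Scope ring_scope.

(** * Directional derivatives *)

(** Put g = al w + be and U = C / sqrt w. At a critical point of u - C / sqrt w, a nonzero gradient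
    of u is an eigenvector of - Hess u with eigenvalue w / U. The curvature equation fixes the
    determinant w g, so the other eigenvalue is U g, and everything in the traced expression becomes
    a function of w and U. Up to a positive factor what remains is U^2 g^2 - g - (2 be + 1) (w - 1).
    No bound on the slope is available, so its sign is needed for every w >= 1. Since U^2 w = C^2
    and g >= m w, the first term is at least m C^2 g, which grows linearly in w like the terms to be
    beaten; with be < 1, the condition m^2 C^2 > m + 3 is enough. Where the gradient vanishes the
    eigenvector equation is void, and the comparison of trace and determinant replaces it.

    Smoothness is given only through iterated coordinate derivatives. Additivity in the direction,
    symmetry of mixed derivatives and the second derivative test are therefore derived from the mean
    value theorem on lines. *)

Lemma near_norm_lt (R : realType) (V : normedModType R) (x : V) (P : set V) : nbhs x P ->
  exists2 e : R, 0 < e & forall y, `|y - x| < e -> P y.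
Proof.
move=> /nbhs_normP[e /= e0 He]; exists e => // y ye.
by apply: He; rewrite /ball_ /= distrC.
Qed.

Section DirectionalDerivatives.
Variables (R : realType) (V : normedModType R).
Implicit Types (f : V -> R) (x v w : V).

Lemma near_dist_lt f x (e : R) : {for x, continuous f} -> 0 < e ->
  \forall y \near x, `|f x - f y| < e.
Proof. by move=> /cvgrPdist_lt; apply. Qed.

Lemma is_derive_lineE f x v (t : R) (d : R) :
  is_derive t 1 (fun s : R => f (x + s *: v)) d = is_derive (x + t *: v) v f d.
Proof.
have E : (fun h : R => h^-1 *: (((fun s : R => f (x + s *: v)) \o shift t)
    (h *: (1 : R)) - f (x + t *: v))) =
  (fun h => h^-1 *: ((f \o shift (x + t *: v)) (h *: v) - f (x + t *: v))).
  apply/funext => h /=; congr (_ *: (f _ - _)).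
  by rewrite [_%:A]mulr1 scalerDl addrCA.
by apply/propext; split => -[]; rewrite /derivable /derive => df dE;
  split; move: df dE; rewrite /derivable /derive E.
Qed.

Lemma is_derive_line0E f x v (d : R) :
  is_derive (0 : R) 1 (fun s : R => f (x + s *: v)) d = is_derive x v f d.
Proof. by rewrite is_derive_lineE scale0r addr0. Qed.

Lemma is_derive_scaledir f x v (k d : R) :
  is_derive x v f d -> is_derive x (k *: v) f (k * d).
Proof.
rewrite -2!is_derive_line0E => H.
have -> : (fun s : R => f (x + s *: (k *: v))) =
    (fun s : R => f (x + s *: v)) \o (fun s : R => k * s).
  by apply/funext => s /=; rewrite scalerA mulrC.
rewrite mulrC; apply: is_derive1_comp; first by rewrite mulr0.
by apply: is_derive_eq; rewrite [LHS]mulr1.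
Qed.

Lemma is_derive0_approx (g : R -> R) (d : R) :
  (forall e : R, 0 < e ->
     \forall h \near (0 : R), `|g h - g 0 - h * d| <= e * `|h|) ->
  is_derive (0 : R) 1 g d.
Proof.
move=> H.
have C : (fun h : R => h^-1 *: ((g \o shift 0) (h *: (1 : R)) - g 0)) @ 0^' --> d.
  apply/cvgrPdist_le => e e0; have := H _ e0.
  rewrite near_withinE; apply: filterS => h hh h0 /=.
  rewrite addr0 [_%:A]mulr1 /GRing.scale /=.
  rewrite -(ler_pM2r (_ : 0 < `|h|)) ?normr_gt0// -normrM.
  apply: le_trans hh; rewrite -normrN.
  have -> : - ((d - h^-1 * (g h - g 0)) * h) = h^-1 * h * (g h - g 0) - h * d by ring.
  by rewrite mulVf// mul1r.
by split; [apply/cvg_ex; exists d|exact: cvg_lim].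
Qed.

Lemma is_derive_approx f x v (d e : R) : is_derive x v f d -> 0 < e ->
  \forall h \near (0 : R), `|f (x + h *: v) - (f x + h * d)| <= e * `|h|.
Proof.
move=> [df <-] e0; have /eqaddoP/(_ _ e0) := derivable_nbhs df.
rewrite near_simpl; apply: filterS => h /=; rewrite !fctE /=.
by rewrite [h *: v + x]addrC.
Qed.

Local Opaque derive.

Lemma MVT_line f x v (s : R) :
  (forall c : R, 0 <= c <= 1 -> derivable f (x + (c * s) *: v) v) ->
  exists2 c : R, 0 <= c <= 1 & f (x + s *: v) - f x = s * 'D_v f (x + (c * s) *: v).
Proof.
move=> df.
pose g (c : R) := f (x + c *: (s *: v)).
have dg (c : R) : c \in `[(0:R), 1] -> is_derive c 1 g (s * 'D_v f (x + (c * s) *: v)).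
  rewrite in_itv /= => c01.
  rewrite is_derive_lineE; apply: is_derive_scaledir; rewrite scalerA.
  exact/derivableP/df.
have dg' (c : R) : c \in `](0:R), 1[ -> is_derive c 1 g (s * 'D_v f (x + (c * s) *: v)).
  by move=> c01; apply: dg; apply: subset_itv_oo_cc c01.
have cg : {within `[(0:R), 1], continuous g}.
  by apply: derivable_within_continuous => c /dg[].
have [c c01] := MVT_segment ler01 dg' cg.
rewrite /g scale1r scale0r addr0 subr0 mulr1 => E.
by exists c => //; move: c01; rewrite in_itv.
Qed.

(** Go from x to x + h w, then on to x + h w + h v. The second increment is a derivative along v at
    an intermediate point, which tends to x, so continuity of that derivative suffices; along w only
    derivability at x enters. *)
Lemma is_derive_dirD f x v w :
  (\forall y \near x, derivable f y v) -> {for x, continuous ('D_v f)} ->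
  derivable f x w -> is_derive x (v + w) f ('D_v f x + 'D_w f x).
Proof.
move=> dv cv dw; rewrite -is_derive_line0E.
apply: is_derive0_approx => e e0.
have e20 : 0 < e / 2 by rewrite divr_gt0.
have [r r0 Hr] := near_norm_lt (filterI dv (near_dist_lt cv e20)).
have Hw := is_derive_approx (derivableP dw) e20.
have M0 : 0 < `|v| + `|w| + 1 by rewrite ltr_wpDl// addr_ge0.
have Hn : \forall h \near (0 : R), `|h| < r / (`|v| + `|w| + 1).
  by apply: (@nbhs0_lt _ R); rewrite divr_gt0.
near=> h.
have hr : `|h| * (`|v| + `|w| + 1) < r.
  by rewrite -ltr_pdivlMr//; near: h.
have hb (c : R) : 0 <= c <= 1 -> `|x + h *: w + (c * h) *: v - x| < r.
  move=> /andP[c0 c1]; apply: le_lt_trans hr.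
  rewrite addrC -[x + _ + _]addrA addKr; apply: le_trans (ler_normD _ _) _.
  rewrite 2!normrZ normrM (ger0_norm c0) !mulrDr mulr1.
  rewrite addrC ler_wpDr// lerD2r ler_wpM2r// ler_piMl//.
have [c c01 Ec] : exists2 c : R, 0 <= c <= 1 &
   f (x + h *: w + h *: v) - f (x + h *: w) = h * 'D_v f (x + h *: w + (c * h) *: v).
  by apply: MVT_line => c /hb /Hr[].
have -> : x + h *: (v + w) = x + h *: w + h *: v by rewrite scalerDr addrA addrAC.
rewrite scale0r addr0.
have -> : f (x + h *: w + h *: v) - f x - h * ('D_v f x + 'D_w f x) =
   - (h * ('D_v f x - 'D_v f (x + h *: w + (c * h) *: v))) +
   (f (x + h *: w) - (f x + h * 'D_w f x)).
  rewrite mulrBr -Ec; move: (f _) (f _) (f _) ('D_v f x) ('D_w f x) => *; ring.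
have -> : e * `|h| = `|h| * (e / 2) + e / 2 * `|h| by field.
apply: le_trans (ler_normD _ _) _; rewrite normrN normrM; apply: lerD.
  by apply: ler_wpM2l => //; apply: ltW; case: (Hr _ (hb _ c01)).
by near: h.
Unshelve. all: by end_near. Qed.

(** The mean value theorem is applied along v to the increment in w, then along w. The left side is
    symmetric in v and w, so exchanging them compares the two mixed derivatives. *)
Lemma second_difference f x v w (e : R) (s : R) :
  (forall y, `|y - x| < e -> derivable f y v) ->
  (forall y, `|y - x| < e -> derivable ('D_v f) y w) ->
  `|s| * (`|v| + `|w|) < e ->
  exists2 z, `|z - x| <= `|s| * (`|v| + `|w|) &
    f (x + s *: v + s *: w) - f (x + s *: v) - f (x + s *: w) + f x =
    s ^+ 2 * 'D_w ('D_v f) z.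
Proof.
move=> dv dw se.
have B (a b : R) : 0 <= a <= 1 -> 0 <= b <= 1 ->
    `|x + (a * s) *: v + (b * s) *: w - x| <= `|s| * (`|v| + `|w|).
  move=> /andP[a0 a1] /andP[b0 b1].
  rewrite addrC -[x + _ + _]addrA addKr; apply: le_trans (ler_normD _ _) _.
  rewrite (normrZ _ v) (normrZ _ w) !normrM (ger0_norm a0) (ger0_norm b0) mulrDr.
  by apply: lerD; rewrite ler_wpM2r// ler_piMl.
pose g y := f (y + s *: w) - f y.
have dg (c : R) : 0 <= c <= 1 -> is_derive (x + (c * s) *: v) v g
    ('D_v f (x + (c * s) *: v + s *: w) - 'D_v f (x + (c * s) *: v)).
  move=> c01; apply: is_deriveB; last first.
    apply/derivableP/dv; apply: le_lt_trans se.
    have /(_ 0) := B c _ c01; rewrite mul0r scale0r addr0; apply.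
    by rewrite lexx ler01.
  have D : is_derive (x + (c * s) *: v + s *: w) v f ('D_v f (x + (c * s) *: v + s *: w)).
    apply/derivableP/dv; apply: le_lt_trans se.
    have /(_ 1) := B c _ c01; rewrite mul1r; apply.
    by rewrite lexx ler01.
  move: D; rewrite -!is_derive_line0E; congr (is_derive _ _ _ _).
  by apply/funext => t; rewrite addrAC.
have [c c01 Ec] : exists2 c : R, 0 <= c <= 1 &
    g (x + s *: v) - g x = s * 'D_v g (x + (c * s) *: v).
  by apply: MVT_line => c /dg[].
have [d d01 Ed] : exists2 d : R, 0 <= d <= 1 &
    'D_v f (x + (c * s) *: v + s *: w) - 'D_v f (x + (c * s) *: v) =
    s * 'D_w ('D_v f) (x + (c * s) *: v + (d * s) *: w).
  apply: (@MVT_line ('D_v f) (x + (c * s) *: v) w s) => d d01.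
  by apply: dw; apply: le_lt_trans se; exact: B.
exists (x + (c * s) *: v + (d * s) *: w); first exact: B.
rewrite expr2 -mulrA -Ed; have [_ <-] := dg _ c01; rewrite -Ec /g.
move: (f _) (f _) (f _) (f _) => *; ring.
Qed.

Lemma derive_commute f x v w :
  (\forall y \near x, derivable f y v) -> (\forall y \near x, derivable f y w) ->
  (\forall y \near x, derivable ('D_v f) y w) ->
  (\forall y \near x, derivable ('D_w f) y v) ->
  {for x, continuous ('D_w ('D_v f))} -> {for x, continuous ('D_v ('D_w f))} ->
  'D_w ('D_v f) x = 'D_v ('D_w f) x.
Proof.
move=> dv dw dvw dwv cvw cwv.
apply/eqP; rewrite -subr_eq0 -normr_le0; apply/ler_addgt0Pl => e e0; rewrite addr0.
have e20 : 0 < e / 2 by rewrite divr_gt0.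
have [r r0 Hr] := near_norm_lt (filterI (filterI (filterI dv dw) (filterI dvw dwv))
  (filterI (near_dist_lt cvw e20) (near_dist_lt cwv e20))).
(* Small enough for the parallelogram with sides s v and s w to stay in the ball of radius r; the
   summand 1 keeps the denominator positive when v = w = 0. *)
pose s := r / (2 * (`|v| + `|w| + 1)).
have M0 : 0 < `|v| + `|w| + 1 by rewrite ltr_wpDl// addr_ge0.
have s0 : 0 < s by rewrite divr_gt0// mulr_gt0.
have sr : `|s| * (`|v| + `|w|) < r.
  rewrite gtr0_norm//; apply: (@le_lt_trans _ _ (s * (`|v| + `|w| + 1))).
    by rewrite ler_pM2l// lerDl.
  rewrite /s invfM !mulrA mulfVK ?gt_eqF//; lra.
have sr' : `|s| * (`|w| + `|v|) < r by rewrite [`|w| + _]addrC.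
have [z1 z1r E1] : exists2 z, `|z - x| <= `|s| * (`|v| + `|w|) &
    f (x + s *: v + s *: w) - f (x + s *: v) - f (x + s *: w) + f x =
    s ^+ 2 * 'D_w ('D_v f) z.
  by apply: second_difference sr => y /Hr [[[? ?] [? ?]] _].
have [z2 z2r E2] : exists2 z, `|z - x| <= `|s| * (`|w| + `|v|) &
    f (x + s *: w + s *: v) - f (x + s *: w) - f (x + s *: v) + f x =
    s ^+ 2 * 'D_v ('D_w f) z.
  by apply: second_difference sr' => y /Hr [[[? ?] [? ?]] _].
have E : 'D_w ('D_v f) z1 = 'D_v ('D_w f) z2.
  apply: (@mulfI _ (s ^+ 2)); first by rewrite expf_neq0// gt_eqF.
  apply: etrans (esym E1) _; apply: etrans _ E2.
  by rewrite [x + s *: w + _]addrAC [_ - f (x + s *: w) - _]addrAC.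
have [_ [H1 _]] := Hr _ (le_lt_trans z1r sr).
have [_ [_ H2]] := Hr _ (le_lt_trans z2r sr').
have -> : 'D_w ('D_v f) x - 'D_v ('D_w f) x =
  ('D_w ('D_v f) x - 'D_w ('D_v f) z1) - ('D_v ('D_w f) x - 'D_v ('D_w f) z2).
  by rewrite E opprB addrA subrK.
apply: le_trans (ler_normB _ _) _.
rewrite [leRHS](_ : _ = e / 2 + e / 2); last by field.
by apply: lerD; apply: ltW; [exact: H1|exact: H2].
Qed.

Lemma derive_at_local_max f x v d :
  (\forall y \near x, derivable f y v) -> is_derive x v ('D_v f) d ->
  (\forall y \near x, f y <= f x) -> 'D_v f x = 0 /\ d <= 0.
Proof.
move=> dv dd mx.
have [r r0 Hr] := near_norm_lt (filterI dv mx).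
have M0 : 0 < `|v| + 1 by rewrite ltr_wpDl.
pose s := r / (`|v| + 1).
have s0 : 0 < s by rewrite divr_gt0.
have hb (t : R) : `|t| < s -> `|x + t *: v - x| < r.
  move=> ts; rewrite addrC addKr normrZ; apply: (@le_lt_trans _ _ (`|t| * (`|v| + 1))).
    by rewrite ler_wpM2l// lerDl.
  by rewrite -ltr_pdivlMr.
pose g (t : R) := f (x + t *: v).
have dg (t : R) : `|t| < s -> is_derive t 1 g ('D_v f (x + t *: v)).
  by move=> /hb/Hr[? _]; rewrite is_derive_lineE; exact: derivableP.
have D0 : 'D_v f x = 0.
  have I0 (t : R) : t \in `]- s, s[ -> `|t| < s by rewrite in_itv /= -ltr_norml.
  have [_ H] : is_derive (0 : R) 1 g 0.
    apply: (@derive1_at_max _ g (- s) s 0).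
    - by rewrite (@le_trans _ _ 0)// ?oppr_le0 ltW.
    - by move=> t /I0/dg[].
    - by rewrite in_itv /= oppr_lt0 s0.
    - by move=> t /I0/hb/Hr[_]; rewrite /g scale0r addr0.
  have s00 : `|0 : R| < s by rewrite normr0.
  have [_ H'] := dg 0 s00.
  by rewrite -H H' scale0r addr0.
(* If d > 0, the first-order expansion of ['D_v f] with error d / 2 makes it positive just after x
   on the line, so f increases there beyond its maximum. *)
split => //; rewrite leNgt; apply/negP => d0.
have [q q0 Hq] := near_norm_lt (is_derive_approx dd (divr_gt0 d0 (ltr0Sn R 1))).
pose t := Num.min s q / 2.
have m0 : 0 < Num.min s q by rewrite lt_min s0.
have t0 : 0 < t by rewrite divr_gt0.
have tm : t < Num.min s q by rewrite /t; lra.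
have [ts tq] : t < s /\ t < q by move: tm; rewrite lt_min => /andP[].
have pos (c : R) : 0 < c <= t -> 0 < 'D_v f (x + c *: v).
  move=> /andP[c0 ct]; have /= := Hq c.
  rewrite subr0 gtr0_norm// (le_lt_trans ct)// => /(_ isT).
  rewrite D0 add0r.
  rewrite ler_distl => /andP[+ _].
  apply: lt_le_trans; rewrite (_ : _ - _ = c * d / 2); last by field.
  by rewrite divr_gt0// mulr_gt0.
have [c] : exists2 c : R, c \in `]0, t[ &
    g t - g 0 = 'D_v f (x + c *: v) * (t - 0).
  apply: (@MVT _ g (fun t => 'D_v f (x + t *: v)) 0 t t0).
  - move=> c; rewrite in_itv /= => /andP[c0 ct]; apply: dg.
    by rewrite gtr0_norm// (lt_trans ct).
  - apply: derivable_within_continuous => c; rewrite in_itv /= => /andP[c0 ct].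
    have cs : `|c| < s by rewrite ger0_norm// (le_lt_trans ct).
    by have [] := dg c cs.
rewrite in_itv /= subr0 => /andP[c0 ct] E.
have : 0 < g t - g 0 by rewrite E mulr_gt0// pos// c0 ltW.
rewrite subr_gt0 /g scale0r addr0 ltNge.
have ts' : `|t| < s by rewrite gtr0_norm.
by have [_ ->] := Hr _ (hb _ ts').
Qed.

End DirectionalDerivatives.

(** * Smooth functions and the second derivative test *)

Section SmoothFunctions.
Variables (R : realType) (n : nat).
Implicit Types (U : set 'rV[R]_n.+1) (f g : 'rV[R]_n.+1 -> R).

Lemma is_derive_eq_on U f g (x v : 'rV[R]_n.+1) (d : R) :
  open U -> U x -> (forall y, U y -> f y = g y) ->
  is_derive x v f d -> is_derive x v g d.
Proof.
move=> oU Ux fg; apply: near_eq_is_derive.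
by apply: filterS (open_nbhs_nbhs (conj oU Ux)).
Qed.

Lemma partial_eq_on U f g (x : 'rV[R]_n.+1) (i : 'I_n.+1) :
  open U -> U x -> (forall y, U y -> f y = g y) ->
  partial i f x = partial i g x.
Proof.
move=> oU Ux fg; apply: near_eq_derive.
by apply: filterS (open_nbhs_nbhs (conj oU Ux)).
Qed.

Lemma continuous_eq_on U f g (x : 'rV[R]_n.+1) :
  open U -> U x -> (forall y, U y -> f y = g y) ->
  {for x, continuous f} -> {for x, continuous g}.
Proof.
move=> oU Ux fg cf; rewrite /prop_for /continuous_at -(fg _ Ux).
apply: cvg_trans cf; apply: near_eq_cvg; first exact: (@nbhs_filter _ x).
by apply: filterS (open_nbhs_nbhs (conj oU Ux)) => y Uy; apply: fg.
Qed.

Lemma Ck_on_continuous k U f x : Ck_on k U f -> U x -> {for x, continuous f}.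
Proof. by case: k => [|k] [cf _] /cf. Qed.

Lemma Ck_onW k U f : Ck_on k.+1 U f -> Ck_on k U f.
Proof.
elim: k f => [|k IH] f; first by case.
move=> [cf H]; split => // i; have [df Hi] := H i.
by split => //; exact: IH.
Qed.

(** The sum and product rules for [partial] are equalities on [U] only, where derivability is known.
    The inductions below pass through this lemma to use them; openness makes derivatives depend on
    the values on [U] alone. *)
Lemma Ck_on_eq k U f g : open U -> (forall y, U y -> f y = g y) ->
  Ck_on k U f -> Ck_on k U g.
Proof.
move=> oU; elim: k f g => [|k IH] f g fg [cf H]; split.
- by move=> x Ux; apply: (continuous_eq_on oU Ux fg); exact: cf.
- by [].
- by move=> x Ux; apply: (continuous_eq_on oU Ux fg); exact: cf.
move=> i; have [df Hi] := H i; split.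
  move=> x Ux; have [] // : is_derive x (delta_mx 0 i) g (partial i f x).
  exact: is_derive_eq_on oU Ux fg (derivableP (df x Ux)).
by apply: IH Hi => x Ux; apply: partial_eq_on fg.
Qed.

Lemma Ck_on_cst k U (c : R) : Ck_on k U (fun=> c).
Proof.
elim: k c => [|k IH] c; split => //; try by move=> x _; exact: cst_continuous.
move=> i; split; first by move=> x _; exact: derivable_cst.
have -> : partial i (fun=> c) = (fun=> 0).
  by apply/funext => x; rewrite /partial derive_cst.
exact: IH.
Qed.

Lemma Ck_onD k U f g : open U -> Ck_on k U f -> Ck_on k U g ->
  Ck_on k U (fun x => f x + g x).
Proof.
move=> oU; elim: k f g => [|k IH] f g [cf Hf] [cg Hg].
  by split => // x Ux; apply: continuousD; [exact: cf|exact: cg].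
split; first by move=> x Ux; apply: continuousD; [exact: cf|exact: cg].
move=> i; have [df Hf'] := Hf i; have [dg Hg'] := Hg i; split.
  by move=> x Ux; apply: derivableD; [exact: df|exact: dg].
apply: (@Ck_on_eq _ _ (fun x => partial i f x + partial i g x)) => //.
  by move=> x Ux; rewrite [RHS]deriveD//; [exact: df|exact: dg].
exact: IH.
Qed.

Lemma Ck_onM k U f g : open U -> Ck_on k U f -> Ck_on k U g ->
  Ck_on k U (fun x => f x * g x).
Proof.
move=> oU; elim: k f g => [|k IH] f g Cf Cg.
  case: Cf => cf _; case: Cg => cg _; split => // x Ux.
  by apply: continuousM; [exact: cf|exact: cg].
(* The product rule pairs each factor with a derivative of the other, so the induction hypothesis is
   also applied to the undifferentiated factors. *)
have Cf' := Ck_onW Cf; have Cg' := Ck_onW Cg.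
case: (Cf) => cf Hf; case: (Cg) => cg Hg; split.
  by move=> x Ux; apply: continuousM; [exact: cf|exact: cg].
move=> i; have [df Hf'] := Hf i; have [dg Hg'] := Hg i; split.
  by move=> x Ux; apply: derivableM; [exact: df|exact: dg].
apply: (@Ck_on_eq _ _ (fun x => f x * partial i g x + g x * partial i f x)) => //.
  by move=> x Ux; rewrite [RHS]deriveM//; [exact: df|exact: dg].
by apply: Ck_onD => //; exact: IH.
Qed.

Lemma is_derive_coord (x v : 'rV[R]_n.+1) (j : 'I_n.+1) :
  is_derive x v (fun y : 'rV[R]_n.+1 => y 0 j) (v 0 j).
Proof.
rewrite -is_derive_line0E.
rewrite (_ : (fun s : R => _) = cst (x 0 j) + (fun s : R => v 0 j * s)).
  by apply: is_derive_eq; rewrite add0r [LHS]mulr1.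
by apply/funext => s; rewrite !mxE mulrC.
Qed.

Lemma partial_coord (i j : 'I_n.+1) :
  partial i (fun y : 'rV[R]_n.+1 => y 0 j) = (fun=> (j == i)%:R).
Proof.
apply/funext => x; have [_] := is_derive_coord x (delta_mx 0 i) j.
by rewrite mxE eqxx.
Qed.

Lemma Ck_on_coord k U j : Ck_on k U (fun y : 'rV[R]_n.+1 => y 0 j).
Proof.
case: k => [|k]; split => //; try by move=> x _; exact: coord_continuous.
move=> i; split; last by rewrite partial_coord; exact: Ck_on_cst.
by move=> x _; have [] := is_derive_coord x (delta_mx 0 i) j.
Qed.

Lemma smooth_onD U f g : open U -> smooth_on U f -> smooth_on U g ->
  smooth_on U (fun x => f x + g x).
Proof. by move=> oU Cf Cg k; apply: Ck_onD. Qed.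

Lemma smooth_onM U f g : open U -> smooth_on U f -> smooth_on U g ->
  smooth_on U (fun x => f x * g x).
Proof. by move=> oU Cf Cg k; apply: Ck_onM. Qed.

Lemma smooth_on_cst U (c : R) : smooth_on U (fun=> c).
Proof. by move=> k; exact: Ck_on_cst. Qed.

Lemma smooth_on_coord U j : smooth_on U (fun y : 'rV[R]_n.+1 => y 0 j).
Proof. by move=> k; exact: Ck_on_coord. Qed.

Lemma smooth_onX U f m : open U -> smooth_on U f ->
  smooth_on U (fun x => f x ^+ m).
Proof.
move=> oU Cf; elim: m => [|m IH]; first exact: smooth_on_cst.
under eq_fun do rewrite exprS.
exact: smooth_onM.
Qed.

Lemma smooth_on_partial U f i : smooth_on U f -> smooth_on U (partial i f).
Proof. by move=> Cf k; have [_ /(_ i)[]] := Cf k.+1. Qed.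

Lemma smooth_on_continuous U f x : smooth_on U f -> U x ->
  {for x, continuous f}.
Proof. by move=> Cf; exact: Ck_on_continuous (Cf 0%N). Qed.

Lemma smooth_on_is_derive U f i x : smooth_on U f -> U x ->
  is_derive x (delta_mx 0 i) f (partial i f x).
Proof. by move=> Cf Ux; have [_ /(_ i)[/(_ x Ux)/derivableP]] := Cf 1%N. Qed.

Lemma partial_commute U f i j x : open U -> smooth_on U f -> U x ->
  partial i (partial j f) x = partial j (partial i f) x.
Proof.
move=> oU Cf Ux.
have nU (P : set 'rV[R]_n.+1) : (forall y, U y -> P y) -> \forall y \near x, P y.
  by move=> UP; apply: filterS (open_nbhs_nbhs (conj oU Ux)).
apply: derive_commute.
- by apply: nU => y Uy; have [] := smooth_on_is_derive j Cf Uy.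
- by apply: nU => y Uy; have [] := smooth_on_is_derive i Cf Uy.
- by apply: nU => y Uy; have [] := smooth_on_is_derive i (smooth_on_partial j Cf) Uy.
- by apply: nU => y Uy; have [] := smooth_on_is_derive j (smooth_on_partial i Cf) Uy.
- exact: smooth_on_continuous (smooth_on_partial i (smooth_on_partial j Cf)) Ux.
- exact: smooth_on_continuous (smooth_on_partial j (smooth_on_partial i Cf)) Ux.
Qed.

End SmoothFunctions.

Local Opaque derive.

Section SecondDerivativeTest.
Variables (R : realType) (U : set 'rV[R]_2) (oU : open U).
Implicit Type f : 'rV[R]_2 -> R.

Lemma smooth_on_is_derive_comb f (x : 'rV[R]_2) (a b : R) :
  smooth_on U f -> U x ->
  is_derive x (a *: delta_mx 0 0 + b *: delta_mx 0 1) f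
    (a * partial 0 f x + b * partial 1 f x).
Proof.
move=> Cf Ux.
have D (k : R) i y : U y ->
    is_derive y (k *: delta_mx 0 i) f (k * partial i f y).
  by move=> Uy; exact: is_derive_scaledir (smooth_on_is_derive i Cf Uy).
have [d1 <-] := D b 1 x Ux; have [_ <-] := D a 0 x Ux.
apply: is_derive_dirD; last exact: d1.
  by apply: filterS (open_nbhs_nbhs (conj oU Ux)) => y /(D a 0)[].
apply: (@continuous_eq_on _ _ U (fun y => a * partial 0 f y)) => //.
  by move=> y /(D a 0)[_ ->].
apply: smooth_on_continuous Ux; apply: smooth_onM => //.
  exact: smooth_on_cst.
exact: smooth_on_partial.
Qed.

(** The one-dimensional test is applied in every direction, not only along the axes, so that the
    mixed derivative is controlled as well. *)
Lemma smooth_on_local_max f (x : 'rV[R]_2) :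
  smooth_on U f -> U x -> (\forall y \near x, f y <= f x) ->
  (forall i, partial i f x = 0) /\
  forall a b : R, a ^+ 2 * partial 0 (partial 0 f) x +
    2 * a * b * partial 0 (partial 1 f) x +
    b ^+ 2 * partial 1 (partial 1 f) x <= 0.
Proof.
move=> Cf Ux mx.
have H a b : a * partial 0 f x + b * partial 1 f x = 0 /\
    a ^+ 2 * partial 0 (partial 0 f) x +
    2 * a * b * partial 0 (partial 1 f) x +
    b ^+ 2 * partial 1 (partial 1 f) x <= 0.
  set v : 'rV[R]_2 := a *: delta_mx 0 0 + b *: delta_mx 0 1.
  have Dv y : U y -> is_derive y v f (a * partial 0 f y + b * partial 1 f y).
    exact: smooth_on_is_derive_comb.
  have Cg : smooth_on U (fun y => a * partial 0 f y + b * partial 1 f y).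
    by apply: smooth_onD => //; apply: smooth_onM => //;
      (try exact: smooth_on_cst); exact: smooth_on_partial.
  have DDv := smooth_on_is_derive_comb a b Cg Ux.
  have DDv' : is_derive x v ('D_v f)
      (a * partial 0 (fun y => a * partial 0 f y + b * partial 1 f y) x
       + b * partial 1 (fun y => a * partial 0 f y + b * partial 1 f y) x).
    apply: (is_derive_eq_on oU Ux _ DDv) => y /Dv[_ ->//].
  have nv : \forall y \near x, derivable f y v.
    by apply: filterS (open_nbhs_nbhs (conj oU Ux)) => y /Dv[].
  have [+ E2] := derive_at_local_max nv DDv' mx.
  have [_ ->] := Dv x Ux => E1; split; [exact: E1|apply: le_trans E2].
  have P i : partial i (fun y => a * partial 0 f y + b * partial 1 f y) x =
      a * partial i (partial 0 f) x + b * partial i (partial 1 f) x.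
    have D j := smooth_on_is_derive i (smooth_on_partial j Cf) Ux.
    have [_] := is_deriveD (is_deriveZ a (D 0)) (is_deriveZ b (D 1)).
    by [].
  rewrite (P 0) (P 1) (partial_commute 1 0 oU Cf Ux).
  set p := partial 0 (partial 0 f) x; set q := partial 0 (partial 1 f) x.
  set r := partial 1 (partial 1 f) x.
  by move: p q r => p q r; rewrite le_eqVlt; apply/orP; left; apply/eqP; ring.
split; last by move=> a b; have [] := H a b.
move=> i; have [[+ _] [+ _]] := (H 1 0, H 0 1).
rewrite !mul1r !mul0r addr0 add0r => H0 H1.
by case: i => -[|[|//]] ilt; [move: H0|move: H1]; congr (partial _ _ _ = _);
  apply/val_inj.
Qed.

End SecondDerivativeTest.

(** * Differentiation rules *)

Local Opaque partial.

Section PointwiseRules.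
Variables (R : realType) (V : normedModType R) (x v : V).
Implicit Types (f g : V -> R) (a b c : R).

Lemma is_derive_const c : is_derive x v (fun=> c) (0 : R).
Proof. exact: is_derive_cst. Qed.

Lemma is_derive_add f g a b : is_derive x v f a -> is_derive x v g b ->
  is_derive x v (fun y => f y + g y) (a + b).
Proof. exact: is_deriveD. Qed.

Lemma is_derive_opp f a : is_derive x v f a ->
  is_derive x v (fun y => - f y) (- a).
Proof. exact: is_deriveN. Qed.

Lemma is_derive_mul f g a b : is_derive x v f a -> is_derive x v g b ->
  is_derive x v (fun y => f y * g y) (f x * b + g x * a).
Proof. exact: is_deriveM. Qed.

Lemma is_derive_exp f a n : is_derive x v f a ->
  is_derive x v (fun y => f y ^+ n) (n%:R * f x ^+ n.-1 * a).
Proof.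
move=> df; rewrite (_ : (fun y => f y ^+ n) = f ^+ n); first exact: is_deriveX.
by apply/funext => y; rewrite exprfctE.
Qed.

Lemma is_derive_inv f a : f x != 0 -> is_derive x v f a ->
  is_derive x v (fun y => (f y)^-1) (- (f x) ^- 2 * a).
Proof.
by move=> fx0 [df <-]; split; [exact: derivableV|exact: deriveV].
Qed.

End PointwiseRules.

Lemma partialE (R : realType) (n : nat) (f : 'rV[R]_n.+1 -> R) i x (d : R) :
  is_derive x (delta_mx 0 i) f d -> partial i f x = d.
Proof. by case. Qed.

Lemma is_derive_coord_delta (R : realType) (n : nat) (x : 'rV[R]_n.+1) i j :
  is_derive x (delta_mx 0 i) (fun y : 'rV[R]_n.+1 => y 0 j) ((j == i)%:R : R).
Proof. by have := is_derive_coord x (delta_mx 0 i) j; rewrite mxE eqxx. Qed.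

(** Usually run after [is_derive_eq], while the derivative is still unknown: the shape of the
    function determines it. What is left is the nonvanishing of inverted terms. *)
Ltac is_deriv :=
  lazymatch goal with
  | |- is_derive _ _ (fun _ => ?c) _ => exact: is_derive_const
  | |- is_derive _ _ (fun y => fun_of_matrix y _ _) _ => exact: is_derive_coord_delta
  | |- is_derive _ _ (fun y => _ + _) _ => apply: is_derive_add; is_deriv
  | |- is_derive _ _ (fun y => - _) _ => apply: is_derive_opp; is_deriv
  | |- is_derive _ _ (fun y => _ * _) _ => apply: is_derive_mul; is_deriv
  | |- is_derive _ _ (fun y => _ ^+ _) _ => apply: is_derive_exp; is_deriv
  | |- is_derive _ _ (fun y => _^-1) _ =>
      apply: is_derive_inv; [cbv beta | is_deriv]
  | |- is_derive ?x ?v (fun y => @partial ?R ?n ?i ?f y) ?d =>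
      refine (_ : is_derive x v (@partial R n i f) d);
      apply: smooth_on_is_derive; [repeat apply: smooth_on_partial; eassumption|eassumption]
  | |- is_derive ?x ?v (@partial ?R ?n ?i ?f) ?d =>
      apply: smooth_on_is_derive; [repeat apply: smooth_on_partial; eassumption|eassumption]
  | |- is_derive ?x ?v (fun y => ?f y) ?d =>
      refine (_ : is_derive x v f d); eassumption
  | |- _ => eassumption
  end.

(* [ring] and [field] compare atoms up to conversion, which unfolds limits. *)
Ltac gen_partials :=
  repeat match goal with
  | |- context [partial ?i ?f ?x] => generalize (partial i f x); intro
  end.

(** * Matrices and sums of size 2 and 3 *)

Lemma invmx_uniq (R : comUnitRingType) (n : nat) (A B : 'M[R]_n) :
  A *m B = 1%:M -> invmx A = B.
Proof.
move=> AB; have [Au _] := mulmx1_unit AB.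
by rewrite -[LHS]mulmx1 -AB mulKmx.
Qed.

Lemma big_ord2 (R : nmodType) (F : 'I_2 -> R) : \sum_k F k = F 0 + F 1.
Proof.
by rewrite !big_ord_recl big_ord0 addr0; congr (_ + F _); apply: val_inj.
Qed.

Lemma big_ord3 (R : nmodType) (F : 'I_3 -> R) : \sum_k F k = F 0 + F 1 + F 2.
Proof.
rewrite !big_ord_recl big_ord0 addr0 addrA.
by congr (_ + F _ + F _); apply: val_inj.
Qed.

Lemma ord2P (P : 'I_2 -> Prop) : P 0 -> P 1 -> forall i, P i.
Proof.
move=> P0 P1 [[|[|//]] ilt].
- by rewrite (_ : Ordinal ilt = 0)//; apply: val_inj.
- by rewrite (_ : Ordinal ilt = 1)//; apply: val_inj.
Qed.

Lemma ord3P (P : 'I_3 -> Prop) : P 0 -> P 1 -> P 2 -> forall i, P i.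
Proof.
move=> P0 P1 P2 [[|[|[|//]]] ilt].
- by rewrite (_ : Ordinal ilt = 0)//; apply: val_inj.
- by rewrite (_ : Ordinal ilt = 1)//; apply: val_inj.
- by rewrite (_ : Ordinal ilt = 2)//; apply: val_inj.
Qed.

Lemma det_mx22 (R : comNzRingType) (A : 'M[R]_2) :
  \det A = A 0 0 * A 1 1 - A 0 1 * A 1 0.
Proof.
rewrite (expand_det_row _ 0) big_ord2 /cofactor !det_mx11 !mxE /=.
rewrite expr0 expr1 mul1r mulN1r mulrN.
by congr (_ * A _ _ - _ * A _ _); apply: val_inj.
Qed.

Lemma invmx22 (R : fieldType) (A : 'M[R]_2) : \det A != 0 ->
  invmx A = \matrix_(i, j) ((if i == j then A (1 - i) (1 - i) else - A i j) / \det A).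
Proof.
rewrite det_mx22 => A0; apply: invmx_uniq; apply/matrixP.
by apply: ord2P; apply: ord2P; rewrite !mxE big_ord2 !mxE /= ?subrr ?subr0;
  field.
Qed.

(** * The product metric in coordinates *)

Section AmbientMetric.
Variable R : realType.
Implicit Types (x : 'rV[R]_3).

Definition H2xR_coef x (k : 'I_3) : R := if k == 2 then 1 else (x 0 1) ^- 2.

Lemma H2xR_metricE x (i j : 'I_3) :
  H2xR_metric x i j = if i == j then H2xR_coef x i else 0.
Proof.
have e0 : (0 : 'I_3) = lshift 1 (0 : 'I_2) by apply: val_inj.
have e1 : (1 : 'I_3) = lshift 1 (1 : 'I_2) by apply: val_inj.
have e2 : (2 : 'I_3) = rshift 2 (0 : 'I_1) by apply: val_inj.
have ul (k l : 'I_3) (a b : 'I_2) : k = lshift 1 a -> l = lshift 1 b ->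
    H2xR_metric x k l = (x 0 1 ^- 2) *+ (a == b).
  by move=> -> ->; rewrite [LHS]block_mxEul !mxE -e1.
have ur (k l : 'I_3) (a : 'I_2) (b : 'I_1) : k = lshift 1 a -> l = rshift 2 b ->
    H2xR_metric x k l = 0 by move=> -> ->; rewrite [LHS]block_mxEur mxE.
have dl (k l : 'I_3) (a : 'I_1) (b : 'I_2) : k = rshift 2 a -> l = lshift 1 b ->
    H2xR_metric x k l = 0 by move=> -> ->; rewrite [LHS]block_mxEdl mxE.
have dr : H2xR_metric x 2 2 = 1 by rewrite e2 [LHS]block_mxEdr mxE.
rewrite /H2xR_coef; move: i j; apply: ord3P; apply: ord3P;
  by rewrite ?dr ?(ul _ _ _ _ e0 e0) ?(ul _ _ _ _ e0 e1) ?(ul _ _ _ _ e1 e0)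
    ?(ul _ _ _ _ e1 e1) ?(ur _ _ _ _ e0 e2) ?(ur _ _ _ _ e1 e2)
    ?(dl _ _ _ _ e2 e0) ?(dl _ _ _ _ e2 e1).
Qed.

Lemma H2xR_metric_diag x : H2xR_metric x = diag_mx (\row_k H2xR_coef x k).
Proof.
apply/matrixP => i j; rewrite H2xR_metricE !mxE.
by case: eqP => [->|]; rewrite ?mulr1n ?mulr0n.
Qed.

Lemma inner_H2xR x (v w : 'rV[R]_3) :
  inner (H2xR_metric x) v w = \sum_k v 0 k * H2xR_coef x k * w 0 k.
Proof.
rewrite /inner H2xR_metric_diag mul_mx_diag mxE.
by apply: eq_bigr => k _; rewrite !mxE.
Qed.

Lemma H2xR_metric_inv x : x 0 1 != 0 ->
  invmx (H2xR_metric x) = diag_mx (\row_k (H2xR_coef x k)^-1).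
Proof.
move=> x1; apply: invmx_uniq; rewrite H2xR_metric_diag mulmx_diag.
apply/matrixP => i j; rewrite !mxE mulfV// /H2xR_coef.
by case: (i == 2); rewrite ?oner_eq0// invr_eq0 expf_neq0.
Qed.

Lemma partial_H2xR_metric x (i j l : 'I_3) : x 0 1 != 0 ->
  partial i (fun y => H2xR_metric y j l) x =
  if [&& i == 1, j == l & j != 2] then - 2 * (x 0 1) ^- 3 else 0.
Proof.
move=> x1.
have -> : (fun y : 'rV[R]_3 => H2xR_metric y j l) =
    (fun y => if j == l then H2xR_coef y j else 0).
  by apply/funext => y; exact: H2xR_metricE.
rewrite /H2xR_coef.
have C (c : R) : partial i (fun _ : 'rV[R]_3 => c) x = 0 by exact: derive_cst.
case: (j == l); last by rewrite C andbF.
case: (j == 2); rewrite /= ?andbF ?C// andbT.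
have D : is_derive x (delta_mx 0 i) (fun y : 'rV[R]_3 => (y 0 1) ^- 2)
    (- (x 0 1 ^+ 2) ^- 2 * (2%:R * x 0 1 ^+ 1 * (1 == i)%:R)).
  by is_deriv; rewrite expf_neq0.
rewrite (partialE D).
by rewrite eq_sym; case: (i == 1) => /=; [field|rewrite !mulr0].
Qed.

End AmbientMetric.

(** * The graph of a function and its extrinsic curvature *)

Lemma ord2E : (((0 : 'I_2) == 0) = true) * (((0 : 'I_2) == 1) = false) *
  (((1 : 'I_2) == 0) = false) * (((1 : 'I_2) == 1) = true).
Proof. by []. Qed.

Lemma ord3E : (((0 : 'I_3) == 0) = true) * (((0 : 'I_3) == 1) = false) *
  (((0 : 'I_3) == 2) = false) * (((1 : 'I_3) == 0) = false) *
  (((1 : 'I_3) == 1) = true) * (((1 : 'I_3) == 2) = false) *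
  (((2 : 'I_3) == 0) = false) * (((2 : 'I_3) == 1) = false) *
  (((2 : 'I_3) == 2) = true).
Proof. by []. Qed.

Section Graph.
Variable R : realType.
Implicit Types (u : 'rV[R]_2 -> R) (p : 'rV[R]_2).

Lemma christoffel_H2xR (x : 'rV[R]_3) (k i j : 'I_3) : x 0 1 != 0 ->
  christoffel (@H2xR_metric R) k i j x =
  if k == 0 then
    if (i == 0) && (j == 1) || (i == 1) && (j == 0) then - (x 0 1)^-1 else 0
  else if k == 1 then
    if (i == 0) && (j == 0) then (x 0 1)^-1
    else if (i == 1) && (j == 1) then - (x 0 1)^-1 else 0
  else 0.
Proof.
move=> x1; rewrite /christoffel H2xR_metric_inv// big_ord3.
rewrite !partial_H2xR_metric// !mxE /H2xR_coef.
move: k i j; apply: ord3P; apply: ord3P; apply: ord3P;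
  by rewrite !ord3E /= ?mulr1n ?mulr0n; field.
Qed.

Lemma graph_map0 u p : graph_map u p 0 0 = p 0 0.
Proof.
rewrite (_ : (0 : 'I_3) = lshift 1 (0 : 'I_2)); last exact: val_inj.
by rewrite [LHS]row_mxEl.
Qed.

Lemma graph_map1 u p : graph_map u p 0 1 = p 0 1.
Proof.
rewrite (_ : (1 : 'I_3) = lshift 1 (1 : 'I_2)); last exact: val_inj.
by rewrite [LHS]row_mxEl.
Qed.

Lemma graph_map2 u p : graph_map u p 0 2 = u p.
Proof.
rewrite (_ : (2 : 'I_3) = rshift 2 (0 : 'I_1)); last exact: val_inj.
by rewrite [LHS]row_mxEr mxE.
Qed.

Lemma tangent_graph u (i : 'I_2) p : tangent (graph_map u) i p =
  \row_k (if k == 2 then partial i u p else (k == i :> nat)%:R).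
Proof.
apply/rowP => k; rewrite [LHS]mxE [RHS]mxE; move: k.
apply: ord3P; rewrite !ord3E.
- rewrite (_ : (fun q => _) = (fun q : 'rV[R]_2 => q 0 0)) ?partial_coord//.
  by apply/funext => q; exact: graph_map0.
- rewrite (_ : (fun q => _) = (fun q : 'rV[R]_2 => q 0 1)) ?partial_coord//.
  by apply/funext => q; exact: graph_map1.
- by rewrite (_ : (fun q => _) = u)//; apply/funext => q; exact: graph_map2.
Qed.

Lemma conormal_graph u p : conormal (graph_map u) p =
  \row_k (if k == 2 then 1 else
           if k == 1 then - partial 1 u p else - partial 0 u p).
Proof.
have [a1 a2 a3] : [/\ 0 + 1 = 1 :> 'I_3, 0 + 2 = 2 :> 'I_3 & 1 + 1 = 2 :> 'I_3].
  by split; apply: val_inj.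
have [a4 a5 a6] : [/\ 1 + 2 = 0 :> 'I_3, 2 + 1 = 0 :> 'I_3 & 2 + 2 = 1 :> 'I_3].
  by split; apply: val_inj.
apply/rowP => k; rewrite [LHS]mxE [RHS]mxE (tangent_graph u 0 p) (tangent_graph u 1 p) !mxE.
gen_partials; move: k; apply: ord3P;
  by rewrite ?(a1, a2, a3, a4, a5, a6) ?ord3E /=; ring.
Qed.

(* [1 + |grad u|^2], the inverse square of the angle function. *)
Definition slope u p : R :=
  1 + p 0 1 ^+ 2 * (partial 0 u p ^+ 2 + partial 1 u p ^+ 2).

(** The covariant Hessian of u for the half-plane metric: the second summand is minus the
    Christoffel symbols contracted with du. *)
Definition hess u (i j : 'I_2) p : R :=
  partial i (partial j u) p +
  (if i == j then (-1) ^+ (i == 0) * partial 1 u p else partial 0 u p) / p 0 1.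

Lemma slope_ge1 u p : 1 <= slope u p.
Proof. by rewrite /slope lerDl mulr_ge0 ?addr_ge0 ?sqr_ge0. Qed.

Lemma slope_gt0 u p : 0 < slope u p.
Proof. exact: lt_le_trans (slope_ge1 u p). Qed.

Lemma second_form_graph u p (i j : 'I_2) : p 0 1 != 0 ->
  second_form (@H2xR_metric R) (graph_map u) p i j =
  (Num.sqrt (slope u p))^-1 * hess u i j p.
Proof.
move=> p1; have g1 : graph_map u p 0 1 != 0 by rewrite graph_map1.
have dE k : (H2xR_coef (graph_map u p) k)^-1 = if k == 2 then 1 else p 0 1 ^+ 2.
  by rewrite /H2xR_coef graph_map1; case: ifP; rewrite ?invr1 ?invrK.
have d0 k : H2xR_coef (graph_map u p) k != 0.
  by rewrite /H2xR_coef graph_map1; case: ifP; rewrite ?oner_eq0// invr_neq0// expf_neq0.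
rewrite [LHS]mxE /unit_normal inner_H2xR conormal_graph.
set n := \row_k _; rewrite H2xR_metric_inv//.
set N := n *m _.
have NE k : N 0 k = n 0 k * (H2xR_coef (graph_map u p) k)^-1.
  by rewrite /N mul_mx_diag [LHS]mxE [X in _ * X]mxE.
have -> : inner (H2xR_metric (graph_map u p)) N N = slope u p.
  rewrite inner_H2xR big_ord3 !NE !mulfVK// !dE /n !mxE !ord3E.
  by rewrite /slope; gen_partials; move: (p 0 1) => y; ring.
set s := (Num.sqrt _)^-1.
set c := cov_tangent _ _ _ _ _.
(* The normal is the conormal with its index raised, and the metric lowers it again: the inner
   product is the plain pairing with the conormal (- du, 1). *)
have E k : c 0 k * H2xR_coef (graph_map u p) k * (s *: N) 0 k =
    s * (c 0 k * n 0 k).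
  rewrite [X in _ * _ * X = _]mxE NE; move: (d0 k).
  by move: (H2xR_coef _ _) (c 0 k) (n 0 k) => a b d a0; field.
rewrite big_ord3 !E -!mulrDr; congr (s * _).
have T k : partial i (fun q => tangent (graph_map u) j q 0 k) p =
    if k == 2 then partial i (partial j u) p else 0.
  rewrite (_ : (fun q => _) =
      if k == 2 then partial j u else fun=> (k == j :> nat)%:R).
    by case: ifP => // _; exact: partialE (is_derive_const _ _ _).
  by apply/funext => q; rewrite tangent_graph mxE; case: ifP.
have cE k : c 0 k = (if k == 2 then partial i (partial j u) p else 0) +
    \sum_l \sum_m christoffel (@H2xR_metric R) k l m (graph_map u p) *
      (if l == 2 then partial i u p else (l == i :> nat)%:R) *
      (if m == 2 then partial j u p else (m == j :> nat)%:R).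
  rewrite [LHS]mxE T; congr (_ + _); apply: eq_bigr => l _; apply: eq_bigr => m _.
  by rewrite !tangent_graph !mxE.
rewrite !cE /n !mxE !ord3E !big_ord3 !christoffel_H2xR//.
rewrite !ord3E graph_map1 /hess {E T cE}.
by move: i j @c; apply: ord2P; apply: ord2P; rewrite ?ord2E /=; gen_partials; field.
Qed.

Lemma first_form_graph u p :
  first_form (@H2xR_metric R) (graph_map u) p =
  \matrix_(i, j) ((p 0 1) ^- 2 *+ (i == j) + partial i u p * partial j u p).
Proof.
apply/matrixP => i j; rewrite [LHS]mxE [RHS]mxE inner_H2xR big_ord3 /H2xR_coef graph_map1.
rewrite !tangent_graph !mxE !ord3E.
by move: i j; apply: ord2P; apply: ord2P; rewrite ?ord2E /= ?mulr1n ?mulr0n;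
  gen_partials; ring.
Qed.

Lemma det_first_form_graph u p : p 0 1 != 0 ->
  \det (first_form (@H2xR_metric R) (graph_map u) p) = slope u p / p 0 1 ^+ 4.
Proof.
move=> p1; rewrite first_form_graph det_mx22 !mxE !ord2E mulr1n mulr0n /slope.
by gen_partials; field.
Qed.

Lemma graph_KeE u p : p 0 1 != 0 ->
  graph_Ke u p = p 0 1 ^+ 4 *
    (hess u 0 0 p * hess u 1 1 p - hess u 0 1 p * hess u 1 0 p) /
    slope u p ^+ 2.
Proof.
move=> p1; rewrite /graph_Ke /extrinsic_curvature /shape_operator.
rewrite det_mulmx det_inv det_first_form_graph// det_mx22 !second_form_graph//.
have w0 := slope_gt0 u p.
have s2 := sqr_sqrtr (ltW w0).
have s0 : Num.sqrt (slope u p) != 0 by rewrite gt_eqF// sqrtr_gt0.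
move: s2 s0 {w0}; move: (Num.sqrt _) => s; move: (slope u p) => w <- s0.
move: (hess u 0 0 p) (hess u 1 1 p) (hess u 0 1 p) (hess u 1 0 p) => a b c d.
by field; rewrite p1 s0.
Qed.

End Graph.

(** * The Gauss equation *)

Lemma ord2B : (1 - 0 = 1 :> 'I_2) * (1 - 1 = 0 :> 'I_2).
Proof. by split; apply: val_inj. Qed.

Lemma christoffel_eq (R : realType) (n : nat) (g : 'rV[R]_n.+1 -> 'M[R]_n.+1)
    (x : 'rV[R]_n.+1) (h : 'M[R]_n.+1) (dg : 'I_n.+1 -> 'I_n.+1 -> 'I_n.+1 -> R) :
  g x = h -> (forall i j k, partial k (fun y => g y i j) x = dg i j k) ->
  forall k i j, christoffel g k i j x =
    2^-1 * \sum_l invmx h k l * (dg j l i + dg i l j - dg i j l).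
Proof.
move=> gx dgE k i j; congr (_ * _); apply: eq_bigr => l _.
by rewrite !dgE gx.
Qed.

Lemma riemann_eq (R : realType) (n : nat) (g : 'rV[R]_n.+1 -> 'M[R]_n.+1)
    (x : 'rV[R]_n.+1) (G : 'I_n.+1 -> 'I_n.+1 -> 'I_n.+1 -> R)
    (dG : 'I_n.+1 -> 'I_n.+1 -> 'I_n.+1 -> 'I_n.+1 -> R) :
  (forall k i j, christoffel g k i j x = G k i j) ->
  (forall a k i j, partial a (christoffel g k i j) x = dG a k i j) ->
  forall l i j k, riemann g l i j k x = dG i l j k - dG j l i k +
    \sum_m (G l i m * G m j k - G l j m * G m i k).
Proof.
move=> GE dGE l i j k; rewrite /riemann !dGE; congr (_ + _).
by apply: eq_bigr => m _; rewrite !GE.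
Qed.

Section GaussEquation.
Variables (R : realType) (Omega : set 'rV[R]_2) (u : 'rV[R]_2 -> R).
Hypotheses (oO : open Omega) (OH : Omega `<=` @H2 R) (Cu : smooth_on Omega u).

Lemma H2_neq0 p : Omega p -> p 0 1 != 0.
Proof. by move=> /OH; rewrite /H2 /= => /gt_eqF ->. Qed.

Lemma partial_first_form_graph p (i j k : 'I_2) : Omega p ->
  partial k (fun q => first_form (@H2xR_metric R) (graph_map u) q i j) p =
  (if (i == j) && (k == 1) then - 2 * (p 0 1) ^- 3 else 0) +
  (partial k (partial i u) p * partial j u p +
   partial i u p * partial k (partial j u) p).
Proof.
move=> Op; have p1 := H2_neq0 Op.
have -> : (fun q => first_form (@H2xR_metric R) (graph_map u) q i j) =
    (fun q : 'rV[R]_2 => ((i == j)%:R * (q 0 1 ^+ 2)^-1) + partial i u q * partial j u q).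
  by apply/funext => q; rewrite first_form_graph mxE mulr_natl.
apply: partialE; apply: is_derive_eq.
  by is_deriv; rewrite expf_neq0.
gen_partials; move: k; apply: ord2P; rewrite !ord2E andbC;
  by case: (i == j) => /=; field.
Qed.

Definition dslope (a : 'I_2) (p : 'rV[R]_2) : R :=
  2 * p 0 1 * (1 == a)%:R * (partial 0 u p ^+ 2 + partial 1 u p ^+ 2) +
  p 0 1 ^+ 2 * (2 * partial 0 u p * partial a (partial 0 u) p +
                2 * partial 1 u p * partial a (partial 1 u) p).

Lemma is_derive_slope p a : Omega p ->
  is_derive p (delta_mx 0 a) (slope u) (dslope a p).
Proof.
move=> Op; have -> : slope u = (fun q : 'rV[R]_2 =>
    1 + q 0 1 ^+ 2 * (partial 0 u q ^+ 2 + partial 1 u q ^+ 2)) by [].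
apply: is_derive_eq; first by is_deriv.
by rewrite /dslope /=; gen_partials; move: (p 0 1) (_%:R) => y d; ring.
Qed.

Definition dhess (a i j : 'I_2) (p : 'rV[R]_2) : R :=
  partial a (partial i (partial j u)) p +
  (if i == j then (-1) ^+ (i == 0) * partial a (partial 1 u) p
   else partial a (partial 0 u) p) / p 0 1 -
  (if i == j then (-1) ^+ (i == 0) * partial 1 u p else partial 0 u p)
    * (1 == a)%:R / p 0 1 ^+ 2.

Lemma is_derive_hess p a i j : Omega p ->
  is_derive p (delta_mx 0 a) (hess u i j) (dhess a i j p).
Proof.
move=> Op; have p1 := H2_neq0 Op.
(* The case split becomes a combination with numerical coefficients, a form that [is_deriv] can
   traverse. *)
have -> : hess u i j = (fun q : 'rV[R]_2 => partial i (partial j u) q +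
    ((-1) ^+ (i == 0) *+ (i == j) * partial 1 u q +
      (i != j)%:R * partial 0 u q) * (q 0 1)^-1).
  apply/funext => q; rewrite /hess; congr (_ + _ / _).
  by case: (i == j); rewrite ?mul1r ?mul0r ?addr0 ?add0r.
apply: is_derive_eq; first by is_deriv.
rewrite /dhess; gen_partials; move: p1.
move: (p 0 1) ((1 == a)%:R : R) ((-1) ^+ (i == 0) : R) => y d sg y0.
by case: (i == j); rewrite /= ?mulr1n ?mulr0n; field.
Qed.

(** The Christoffel symbols of the half-plane are these numbers divided by y. *)
Definition H2_christoffel (k i j : 'I_2) : R :=
  if k == 0 then (if i == j then 0 else - 1)
  else if i != j then 0 else if i == 0 then 1 else - 1.

Definition graph_christoffel (k i j : 'I_2) (q : 'rV[R]_2) : R :=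
  H2_christoffel k i j * (q 0 1)^-1
  + q 0 1 ^+ 2 * partial k u q * hess u i j q * (slope u q)^-1.

Lemma partial_graph_christoffel a k i j p : Omega p ->
  partial a (graph_christoffel k i j) p =
  - H2_christoffel k i j * (1 == a)%:R / p 0 1 ^+ 2
  + (2 * p 0 1 * (1 == a)%:R * partial k u p * hess u i j p
     + p 0 1 ^+ 2 * partial a (partial k u) p * hess u i j p
     + p 0 1 ^+ 2 * partial k u p * dhess a i j p) / slope u p
  - p 0 1 ^+ 2 * partial k u p * hess u i j p * dslope a p / slope u p ^+ 2.
Proof.
move=> Op; have p1 := H2_neq0 Op.
have w0 : slope u p != 0 by rewrite gt_eqF ?slope_gt0.
apply: partialE; apply: is_derive_eq.
  apply: is_derive_add; first by is_deriv.
  apply: is_derive_mul; last first.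
    by apply: is_derive_inv => //; exact: is_derive_slope.
  apply: is_derive_mul; last exact: is_derive_hess.
  by is_deriv.
gen_partials; move: w0 p1.
move: (H2_christoffel k i j) (hess u i j p) (slope u p) => c h w.
move: (dhess a i j p) (dslope a p) (p 0 1) ((1 == a)%:R : R) => dh dw y d w0 y0.
by rewrite /=; field; rewrite w0 y0.
Qed.

(* For the graph metric [g + du * du] of a metric [g], the Christoffel symbols
   of [g] get the correction [grad^k u * Hess_ij u / (1 + |grad u|^2)]. *)
Lemma christoffel_graph p (k i j : 'I_2) : Omega p ->
  christoffel (first_form (@H2xR_metric R) (graph_map u)) k i j p =
  graph_christoffel k i j p.
Proof.
move=> Op; have p1 := H2_neq0 Op.
have D : \det (first_form (@H2xR_metric R) (graph_map u) p) != 0.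
  by rewrite det_first_form_graph// mulf_neq0 ?invr_neq0 ?expf_neq0// gt_eqF ?slope_gt0.
have w0 : slope u p != 0 by rewrite gt_eqF ?slope_gt0.
have S := partial_commute 1 0 oO Cu Op.
rewrite (christoffel_eq (first_form_graph u p)
  (fun i j k => partial_first_form_graph i j k Op)).
rewrite first_form_graph in D.
have Dw := det_first_form_graph u p1; rewrite first_form_graph in Dw.
rewrite big_ord2.
rewrite (invmx22 D).
rewrite Dw.
move: S w0; move: k i j.
apply: ord2P; apply: ord2P; apply: ord2P.
all: rewrite !mxE /graph_christoffel /H2_christoffel /hess /slope.
all: rewrite ?ord2B ?ord2E /=.
all: gen_partials => -> w0.
all: rewrite ?mulr1n ?mulr0n.
all: rewrite /=.
all: by field; rewrite p1 w0.
Qed.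
(** The term - 1 / w is the sectional curvature of the tangent plane: minus the square of the angle
    function. Both curvatures are expanded in coordinates; the formula for the symbols holds on the
    open [Omega], so it may be differentiated. *)
Lemma graph_KiE p : Omega p ->
  graph_Ki u p = graph_Ke u p - (slope u p)^-1.
Proof.
move=> Op; have p1 := H2_neq0 Op.
have w0 : slope u p != 0 by rewrite gt_eqF ?slope_gt0.
rewrite /graph_Ki /intrinsic_curvature /gauss_curvature graph_KeE//.
rewrite det_first_form_graph// big_ord2.
have P a k i j : partial a (christoffel (first_form (@H2xR_metric R) (graph_map u)) k i j) p =
    partial a (graph_christoffel k i j) p.
  by apply: (partial_eq_on _ oO Op) => q Oq; exact: christoffel_graph.
have C k i j := christoffel_graph k i j Op.
have DP a k i j := etrans (P a k i j) (partial_graph_christoffel a k i j Op).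
rewrite !(riemann_eq C DP) !big_ord2 first_form_graph.
rewrite !mxE.
(* With [S1] the third derivatives of u cancel in the Riemann tensor, and a rational identity in the
   lower derivatives remains. *)
have S := partial_commute 1 0 oO Cu Op.
have S1 := partial_commute 1 0 oO (smooth_on_partial 1 Cu) Op.
move: S S1 w0; rewrite /graph_christoffel /dhess /dslope /H2_christoffel ?ord2E /=.
rewrite /hess /slope ?ord2E /=; gen_partials.
move: p1; move: (p 0 1) => y y0 -> -> w0.
by rewrite mulr1n mulr0n; field; rewrite y0 w0.
Qed.

End GaussEquation.

(** * The test function *)

Section TestFunction.
Variables (R : realType) (Omega : set 'rV[R]_2) (u : 'rV[R]_2 -> R).
Hypotheses (oO : open Omega) (OH : Omega `<=` @H2 R) (Cu : smooth_on Omega u).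

(** The factor y^4 makes this the determinant in the orthonormal frame [y d_0, y d_1], the det (Hess
    u) of the curvature equation. *)
Definition hess_det (p : 'rV[R]_2) : R :=
  p 0 1 ^+ 4 * (hess u 0 0 p * hess u 1 1 p - hess u 0 1 p ^+ 2).

Definition dhess_det (a : 'I_2) (p : 'rV[R]_2) : R :=
  4 * p 0 1 ^+ 3 * (1 == a)%:R *
    (hess u 0 0 p * hess u 1 1 p - hess u 0 1 p ^+ 2) +
  p 0 1 ^+ 4 * (dhess u a 0 0 p * hess u 1 1 p + hess u 0 0 p * dhess u a 1 1 p
    - 2 * hess u 0 1 p * dhess u a 0 1 p).

Lemma is_derive_hess_det p a : Omega p ->
  is_derive p (delta_mx 0 a) hess_det (dhess_det a p).
Proof.
move=> Op; have D00 := is_derive_hess OH Cu a 0 0 Op.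
have D11 := is_derive_hess OH Cu a 1 1 Op.
have D01 := is_derive_hess OH Cu a 0 1 Op.
rewrite /hess_det; apply: is_derive_eq; first by is_deriv.
rewrite /dhess_det /GRing.scale /=; move: (dhess u a 0 0 p) (dhess u a 1 1 p) (dhess u a 0 1 p).
move: (hess u 0 0 p) (hess u 1 1 p) (hess u 0 1 p) (p 0 1) ((1 == a)%:R : R).
by move=> *; ring.
Qed.

Variable t : R.

(* A maximum point of [u - C / sqrt slope], with maximal value [t], is a local
   maximum point of this function, which is free of square roots. *)
Definition test_fun (p : 'rV[R]_2) : R := (u p - t) ^+ 2 * slope u p.

Lemma smooth_on_slope : smooth_on Omega (slope u).
Proof.
apply: smooth_onD => //; first exact: smooth_on_cst.
apply: smooth_onM => //; first by apply: smooth_onX => //; exact: smooth_on_coord.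
by apply: smooth_onD => //; apply: smooth_onX => //; exact: smooth_on_partial.
Qed.

Lemma smooth_on_test_fun : smooth_on Omega test_fun.
Proof.
apply: smooth_onM => //; last exact: smooth_on_slope.
apply: smooth_onX => //.
by apply: smooth_onD => //; exact: smooth_on_cst.
Qed.

Lemma partial_test_fun p i : Omega p ->
  partial i test_fun p =
  2 * (u p - t) * partial i u p * slope u p + (u p - t) ^+ 2 * dslope u i p.
Proof.
move=> Op; apply: partialE; have Du := smooth_on_is_derive i Cu Op.
have Ds := is_derive_slope Cu i Op.
apply: is_derive_eq.
rewrite /GRing.scale /=; gen_partials; move: (u p) (slope u p) (dslope u i p) => *; ring.
Qed.

Lemma partial2_test_fun p a i : Omega p ->
  partial a (partial i test_fun) p =
  2 * partial a u p * partial i u p * slope u p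
  + 2 * (u p - t) * partial a (partial i u) p * slope u p
  + 2 * (u p - t) * partial i u p * dslope u a p
  + 2 * (u p - t) * partial a u p * dslope u i p
  + (u p - t) ^+ 2 * partial a (dslope u i) p.
Proof.
move=> Op; have Du := smooth_on_is_derive a Cu Op.
have Ds := is_derive_slope Cu a Op.
have Sd : smooth_on Omega (dslope u i).
  move=> k; apply: (@Ck_on_eq _ _ _ _ (partial i (slope u))) => //.
    by move=> q Oq; exact: partialE (is_derive_slope Cu i Oq).
  exact: smooth_on_partial smooth_on_slope k.
have Dd := smooth_on_is_derive a Sd Op.
rewrite (partial_eq_on a oO Op (fun q Oq => partial_test_fun i Oq)).
apply: partialE; apply: is_derive_eq; first by is_deriv.
rewrite /GRing.scale /=; gen_partials.
move: (u p) (slope u p) (dslope u i p) (dslope u a p) => *; ring.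
Qed.

Lemma partial_dslope p a i : Omega p ->
  partial a (dslope u i) p =
  2 * (1 == a)%:R * (1 == i)%:R * (partial 0 u p ^+ 2 + partial 1 u p ^+ 2)
  + 2 * p 0 1 * (1 == i)%:R * (2 * partial 0 u p * partial a (partial 0 u) p
                              + 2 * partial 1 u p * partial a (partial 1 u) p)
  + 2 * p 0 1 * (1 == a)%:R * (2 * partial 0 u p * partial i (partial 0 u) p
                              + 2 * partial 1 u p * partial i (partial 1 u) p)
  + p 0 1 ^+ 2 * (2 * partial a (partial 0 u) p * partial i (partial 0 u) p
                + 2 * partial a (partial 1 u) p * partial i (partial 1 u) p
                + 2 * partial 0 u p * partial a (partial i (partial 0 u)) p
                + 2 * partial 1 u p * partial a (partial i (partial 1 u)) p).
Proof.
move=> Op; apply: partialE; rewrite /dslope.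
apply: is_derive_eq; first by is_deriv.
rewrite /=; gen_partials.
move: (p 0 1) ((1 == a)%:R : R) ((1 == i)%:R : R) => *; ring.
Qed.

End TestFunction.

(** * The maximum principle *)

(* At a critical point of the test function [(P, Q)] is zero or an eigenvector,
   with eigenvalue [w / U], of the matrix [A, B; B, C]. *)
Lemma trace_positive (R : realFieldType) (A B C P Q U w al be K m : R) :
  w = 1 + (P ^+ 2 + Q ^+ 2) -> 0 < U -> U ^+ 2 * w = K ->
  A * C - B ^+ 2 = w * (al * w + be) -> 0 < A + C ->
  0 < m -> m <= al -> m <= al + be -> be < 1 -> m + 3 < m ^+ 2 * K ->
  w * P = U * (A * P + B * Q) -> w * Q = U * (B * P + C * Q) ->
  0 < 2 * w * (C * P ^+ 2 - 2 * B * P * Q + A * Q ^+ 2)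
    - 4 * U * w * (w * (al * w + be))
    - 8 * U * (w * (al * w + be)) * (P ^+ 2 + Q ^+ 2)
    + U ^+ 2 * (2 * (w * (al * w + be)) * (A + C)
        + (4 * (2 * al * w + be) - 2)
          * (A * P ^+ 2 + 2 * B * P * Q + C * Q ^+ 2)).
Proof.
move=> wE U0 UK DE tr0 m0 mal malbe be1 mK cP cQ.
have q0 : 0 <= P ^+ 2 + Q ^+ 2 by rewrite addr_ge0 ?sqr_ge0.
have w1 : 1 <= w by rewrite wE lerDl.
have w0 : 0 < w by lra.
have K0 : 0 < K by rewrite -UK mulr_gt0 ?exprn_gt0.
(* The difference (al - m) w + be is smallest at w = 1: this is why m is the minimum of al and al +
   be. *)
have gE : m * w <= al * w + be by nra.
set g := al * w + be in gE DE *.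
have g0 : 0 < g by apply: lt_le_trans gE; exact: mulr_gt0.
(* At a zero gradient w = 1 and U^2 = K, and the claim reduces to U (A + C) > 2. It follows from (A
   + C)^2 >= 4 (A C - B^2) = 4 g and K g >= K m > 1. *)
have [v0|v0] := eqVneq (P ^+ 2 + Q ^+ 2) 0.
  have w1E : w = 1 by rewrite wE v0 addr0.
  have [P0 Q0] : P = 0 /\ Q = 0.
    by move/eqP: v0; rewrite paddr_eq0 ?sqr_ge0// !sqrf_eq0 => /andP[/eqP-> /eqP->].
  rewrite P0 Q0 w1E !mul1r.
  have -> : 2 * 1 * (C * 0 ^+ 2 - 2 * B * 0 * 0 + A * 0 ^+ 2) - 4 * U * 1 * g
     - 8 * U * g * (0 ^+ 2 + 0 ^+ 2) + U ^+ 2 * (2 * g * (A + C)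
        + (4 * (2 * al * 1 + be) - 2) * (A * 0 ^+ 2 + 2 * B * 0 * 0 + C * 0 ^+ 2))
     = 2 * U * g * (U * (A + C) - 2) by ring.
  rewrite !mulr_gt0// subr_gt0.
  have Ut : 0 < U * (A + C) by exact: mulr_gt0.
  have t4 : 4 * g <= (A + C) ^+ 2.
    have -> : 4 * g = 4 * (A * C - B ^+ 2) by rewrite DE w1E mul1r.
    have : 0 <= (A - C) ^+ 2 + 4 * B ^+ 2 by have := sqr_ge0 (A - C); have := sqr_ge0 B; lra.
    nra.
  have Km : 1 < K * m by nra.
  have Kg : 1 < K * g by nra.
  have : 4 < (U * (A + C)) ^+ 2.
    rewrite exprMn; have -> : U ^+ 2 = K by rewrite -UK w1E mulr1.
    nra.
  nra.
(* Multiplying the eigenvector equations by the adjugate matrix shows that this determinant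
   annihilates both P and Q, one of which is nonzero. *)
have det0 : (A * U - w) * (C * U - w) - B ^+ 2 * U ^+ 2 = 0.
  have aP : ((A * U - w) * (C * U - w) - B ^+ 2 * U ^+ 2) * P = 0.
    have -> : ((A * U - w) * (C * U - w) - B ^+ 2 * U ^+ 2) * P =
      (C * U - w) * (U * (A * P + B * Q) - w * P)
       - B * U * (U * (B * P + C * Q) - w * Q) by ring.
    by rewrite -cP -cQ !subrr !mulr0 subrr.
  have aQ : ((A * U - w) * (C * U - w) - B ^+ 2 * U ^+ 2) * Q = 0.
    have -> : ((A * U - w) * (C * U - w) - B ^+ 2 * U ^+ 2) * Q =
      (A * U - w) * (U * (B * P + C * Q) - w * Q)
       - B * U * (U * (A * P + B * Q) - w * P) by ring.
    by rewrite -cP -cQ !subrr !mulr0 subrr.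
  apply/eqP; move: v0; apply: contraNT => d0.
  move/eqP: aP; rewrite mulf_eq0 (negPf d0) /= => /eqP ->.
  move/eqP: aQ; rewrite mulf_eq0 (negPf d0) /= => /eqP ->.
  by rewrite expr0n addr0.
have trE : w * (U * (A + C)) = U ^+ 2 * (w * g) + w ^+ 2.
  by rewrite -DE -[LHS]addr0 -det0; ring.
have {}trE : U * (A + C) = U ^+ 2 * g + w.
  by apply: (mulfI (lt0r_neq0 w0)); rewrite trE; ring.
have HvE : U * (A * P ^+ 2 + 2 * B * P * Q + C * Q ^+ 2) = w * (P ^+ 2 + Q ^+ 2).
  have -> : w * (P ^+ 2 + Q ^+ 2) = P * (w * P) + Q * (w * Q) by ring.
  by rewrite cP cQ; ring.
have qE : P ^+ 2 + Q ^+ 2 = w - 1 by rewrite wE; ring.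
have pos : 0 < - 3 * g * (w - 1) - w * g + U ^+ 2 * g ^+ 2
    + (4 * al * w + 2 * be - 1) * (w - 1).
  have : g + 3 * w < K * m * g.
    rewrite -(ltr_pM2l m0); apply: le_lt_trans (_ : (m + 3) * g < _); first by nra.
    have -> : m * (K * m * g) = m ^+ 2 * K * g by ring.
    by rewrite ltr_pM2r.
  have : K * m * g <= U ^+ 2 * g ^+ 2.
    have -> : K * m * g = U ^+ 2 * g * (m * w) by rewrite -UK; ring.
    have -> : U ^+ 2 * g ^+ 2 = U ^+ 2 * g * g by ring.
    by rewrite ler_pM2l// mulr_gt0// exprn_gt0.
  rewrite /g; nra.
(* The extra factor U brings out U (A + C) and U times the quadratic form at (P, Q), the two
   combinations computed above. *)
rewrite -(pmulr_rgt0 _ U0).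
set S := (X in 0 < U * X).
have -> : U * S = 2 * U ^+ 2 * w * (- 3 * g * (w - 1) - w * g + U ^+ 2 * g ^+ 2
    + (4 * al * w + 2 * be - 1) * (w - 1)).
  have -> : U * S = 2 * w * ((U * (A + C)) * (P ^+ 2 + Q ^+ 2)
      - U * (A * P ^+ 2 + 2 * B * P * Q + C * Q ^+ 2))
    - 4 * U ^+ 2 * w * (w * g) - 8 * U ^+ 2 * (w * g) * (P ^+ 2 + Q ^+ 2)
    + U ^+ 2 * (2 * (w * g) * (U * (A + C)) + (4 * (2 * al * w + be) - 2)
      * (U * (A * P ^+ 2 + 2 * B * P * Q + C * Q ^+ 2))) by rewrite /S; ring.
  by rewrite HvE trE qE /g; ring.
by rewrite mulr_gt0// !mulr_gt0// exprn_gt0.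
Qed.

Section MaximumPrinciple.
Variables (R : realType) (Omega : set 'rV[R]_2) (u : 'rV[R]_2 -> R).
Hypotheses (oO : open Omega) (OH : Omega `<=` @H2 R) (Cu : smooth_on Omega u).

(* Up to first derivatives of [test_fun u t], its Hessian is traced against the
   cofactor matrix of [- Hess u], here written in the orthonormal frame
   [y d_0, y d_1]. The third derivatives of [u] only enter through the gradient
   of [hess_det u], that is, through the differentiated curvature equation. *)
Lemma test_fun_trace (t : R) p : Omega p ->
  let y := p 0 1 in let w := slope u p in let U := u p - t in
  let P := y * partial 0 u p in let Q := y * partial 1 u p in
  let A := - y ^+ 2 * hess u 0 0 p in let B := - y ^+ 2 * hess u 0 1 p in
  let C := - y ^+ 2 * hess u 1 1 p in let D := hess_det u p in
  let psi := test_fun u t in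
  y ^+ 2 * (C * partial 0 (partial 0 psi) p - 2 * B * partial 0 (partial 1 psi) p
    + A * partial 1 (partial 1 psi) p)
  - y * (C - A) * partial 1 psi p - 2 * B * y * partial 0 psi p =
  2 * w * (C * P ^+ 2 - 2 * B * P * Q + A * Q ^+ 2) - 4 * U * w * D
  - 8 * U * D * (P ^+ 2 + Q ^+ 2)
  + U ^+ 2 * (2 * D * (A + C)
     - 2 * (P * (y * dhess_det u 0 p) + Q * (y * dhess_det u 1 p))
     - 2 * (A * P ^+ 2 + 2 * B * P * Q + C * Q ^+ 2)).
Proof.
(* The first-order terms on the left are the Christoffel terms that turn the coordinate Hessian of
   [psi] into the covariant one. *)
move=> Op y w U P Q A B C D psi; have y0 : y != 0 := H2_neq0 OH Op.
have S := partial_commute 1 0 oO Cu Op.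
have S0 := partial_commute 1 0 oO (smooth_on_partial 0 Cu) Op.
have S1 := partial_commute 1 0 oO (smooth_on_partial 1 Cu) Op.
(* Commutation holds on all of the open [Omega], so it can be differentiated once more; this puts
   the third derivatives into a common order. *)
have T a := partial_eq_on a oO Op (fun q Oq => partial_commute 1 0 oO Cu Oq).
have T0 := T 0; have T1 := etrans (T 1) S1; have S0' := etrans S0 T0.
have E a i := partial2_test_fun oO Cu t a i Op.
have F i := partial_test_fun Cu t i Op.
have G a i := partial_dslope Cu a i Op.
have [E00 E01 E11] := And3 (E 0 0) (E 0 1) (E 1 1).
have [F0 F1] := conj (F 0) (F 1).
have [G00 G01 G11] := And3 (G 0 0) (G 0 1) (G 1 1).
rewrite /psi /D /A /B /C /P /Q /w /U /hess_det /dhess_det /dhess /hess.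
move: S S0' S1 T0 T1 E00 E01 E11 F0 F1 G00 G01 G11.
rewrite /dslope /slope ?ord2E /=.
clear S0 T E F G psi D A B C P Q w U.
move: y0; rewrite /y; clear y; gen_partials; move: (p 0 1) (u p - t) => y U y0.
move=> S S0 S1 T0 T1 -> -> -> -> -> -> -> ->.
move: S S0 S1 T0 T1 => -> -> -> -> ->.
by field.
Qed.

Lemma hess_sym p : Omega p -> hess u 1 0 p = hess u 0 1 p.
Proof. by move=> Op; rewrite /hess ?ord2E (partial_commute 1 0 oO Cu Op). Qed.

Lemma hess_detE p : Omega p -> hess_det u p = slope u p ^+ 2 * graph_Ke u p.
Proof.
move=> Op; have y0 := H2_neq0 OH Op.
have w0 : slope u p != 0 by rewrite gt_eqF ?slope_gt0.
rewrite graph_KeE// hess_sym// /hess_det; move: w0 y0.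
move: (slope u p) (p 0 1) (hess u 0 0 p) (hess u 0 1 p) (hess u 1 1 p).
by move=> w y a b c w0 y0; field.
Qed.

(** This is d |grad u|^2 = 2 Hess u (grad u, .) in the frame [y d_0, y d_1]: the derivative of the
    factor y^2 is absorbed by the connection terms of [hess]. It turns criticality of the test
    function into the eigenvector equation. *)
Lemma slope_partialE p : Omega p ->
  p 0 1 * dslope u 0 p = 2 * p 0 1 ^+ 2 *
    (p 0 1 * partial 0 u p * hess u 0 0 p + p 0 1 * partial 1 u p * hess u 0 1 p)
  /\
  p 0 1 * dslope u 1 p = 2 * p 0 1 ^+ 2 *
    (p 0 1 * partial 0 u p * hess u 0 1 p + p 0 1 * partial 1 u p * hess u 1 1 p).
Proof.
move=> Op; have := partial_commute 1 0 oO Cu Op; move: (H2_neq0 OH Op).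
rewrite /dslope /hess ?ord2E /=; gen_partials; move: (p 0 1) => y y0 ->.
by split; field.
Qed.

Section Weingarten.
Variables (a b c : R).
Hypotheses (b0 : 0 < b) (ab0 : 0 < a + b) (W : W_surface a b c Omega u).

Let al := c / (a + b).
Let be := a / (a + b).

Lemma W_hess_det p : Omega p ->
  hess_det u p = slope u p * (al * slope u p + be).
Proof.
move=> Op; have := W Op; rewrite (graph_KiE oO OH Cu Op) (hess_detE Op) /al /be.
have := slope_gt0 u p; move: (slope u p) (graph_Ke u p) => w k w0.
move=> E; have -> : k = (c + a / w) / (a + b).
  by rewrite -E; field; rewrite !gt_eqF.
by field; rewrite !gt_eqF.
Qed.

Lemma W_dhess_det p i : Omega p ->
  dhess_det u i p = (2 * al * slope u p + be) * dslope u i p.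
Proof.
move=> Op; rewrite -(partialE (is_derive_hess_det OH Cu i Op)).
rewrite (partial_eq_on i oO Op W_hess_det); apply: partialE.
have Ds := is_derive_slope Cu i Op.
apply: is_derive_eq; rewrite /GRing.scale /=.
by move: (slope u p) (dslope u i p) => *; ring.
Qed.

Lemma W_no_local_max (t K m : R) p : Omega p ->
  t < u p -> (u p - t) ^+ 2 * slope u p = K ->
  hess u 0 0 p < 0 -> 0 < m -> m <= al -> m <= al + be -> m + 3 < m ^+ 2 * K ->
  ~ \forall q \near p, test_fun u t q <= test_fun u t p.
Proof.
move=> Op tu UK h0 m0 mal malbe mK.
move=> /(smooth_on_local_max oO (smooth_on_test_fun oO Cu t) Op)[crit quad].
have y0 : 0 < p 0 1 := OH Op.
have U0 : 0 < u p - t by rewrite subr_gt0.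
have wE : slope u p = 1 + ((p 0 1 * partial 0 u p) ^+ 2 + (p 0 1 * partial 1 u p) ^+ 2).
  by rewrite /slope !exprMn mulrDr.
have be1 : be < 1 by rewrite /be ltr_pdivrMr// mul1r ltrDl.
have := test_fun_trace t Op; rewrite /= (crit 0) (crit 1) !mulr0 !subr0.
rewrite (W_dhess_det 0 Op) (W_dhess_det 1 Op) (W_hess_det Op).
have [s0 s1] := slope_partialE Op.
have c0 : 2 * (u p - t) * partial 0 u p * slope u p + (u p - t) ^+ 2 * dslope u 0 p = 0.
  by rewrite -(partial_test_fun Cu t _ Op) crit.
have c1 : 2 * (u p - t) * partial 1 u p * slope u p + (u p - t) ^+ 2 * dslope u 1 p = 0.
  by rewrite -(partial_test_fun Cu t _ Op) crit.
have := W_hess_det Op; rewrite /hess_det.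
(* Below, this is the direction (- B, A). Completing the square, A times the cofactor trace is the
   quadratic form at (- B, A) plus A C - B^2 times the form at (1, 0), so both signs are known
   without diagonalizing. *)
have := quad (p 0 1 ^+ 2 * hess u 0 1 p) (- p 0 1 ^+ 2 * hess u 0 0 p).
have := quad 1 0.
move: UK h0 y0 U0 wE c0 c1 s0 s1 (slope_ge1 u p) => {quad crit tu}.
gen_partials.
move: (p 0 1) (hess u 0 0 p) (hess u 0 1 p) (hess u 1 1 p) (dslope u 0 p)
  (dslope u 1 p) (slope u p) (u p - t) => y h00 h01 h11 w0 w1' w U.
move=> UK h0 y0 U0 wE c0 c1 d0 d1 w1 q1 q2 DE.
set P := y * s in wE d0 d1 *; set Q := y * s0 in wE d0 d1 *.
set A := - y ^+ 2 * h00 in q2 *; set B := - y ^+ 2 * h01.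
set C := - y ^+ 2 * h11.
have {}DE : A * C - B ^+ 2 = w * (al * w + be) by rewrite -DE /A /B /C; ring.
have {}d0 : y * w0 = - 2 * (A * P + B * Q) by rewrite d0 /A /B; ring.
have {}d1 : y * w1' = - 2 * (B * P + C * Q) by rewrite d1 /C /B; ring.
have A0 : 0 < A by rewrite /A mulNr oppr_gt0 nmulr_llt0// exprn_gt0.
have g0 : 0 < al * w + be by nra.
have D0 : 0 < A * C - B ^+ 2 by rewrite DE mulr_gt0//; lra.
have C0 : 0 < C by rewrite -(pmulr_rgt0 _ A0); have := sqr_ge0 B; lra.
have cP : w * P = U * (A * P + B * Q).
  apply: (mulfI (lt0r_neq0 U0)); apply/eqP; rewrite -subr_eq0.
  have -> : U * (w * P) - U * (U * (A * P + B * Q)) =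
    y / 2 * (2 * U * s * w + U ^+ 2 * w0) - U ^+ 2 / 2 * (y * w0 - - 2 * (A * P + B * Q)).
    by rewrite /P; field.
  by rewrite c0 d0 subrr !mulr0 subrr.
have cQ : w * Q = U * (B * P + C * Q).
  apply: (mulfI (lt0r_neq0 U0)); apply/eqP; rewrite -subr_eq0.
  have -> : U * (w * Q) - U * (U * (B * P + C * Q)) =
    y / 2 * (2 * U * s0 * w + U ^+ 2 * w1') - U ^+ 2 / 2 * (y * w1' - - 2 * (B * P + C * Q)).
    by rewrite /Q; field.
  by rewrite c1 d1 subrr !mulr0 subrr.
have pos := trace_positive wE U0 UK DE (addr_gt0 A0 C0) m0 mal malbe be1 mK cP cQ.
set X := C * s1 - _ + _ => E.
have X0 : X <= 0.
  rewrite -(pmulr_rle0 _ A0).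
  have -> : A * X = ((y ^+ 2 * h01) ^+ 2 * s1 + 2 * (y ^+ 2 * h01) * A * s2
     + A ^+ 2 * s3) + (A * C - B ^+ 2) * s1 by rewrite /X /B; ring.
  have : (A * C - B ^+ 2) * s1 <= 0 by rewrite pmulr_rle0//; move: q1; lra.
  by move: q2; lra.
suff : 0 < y ^+ 2 * X by rewrite pmulr_rgt0 ?exprn_gt0// ltNge X0.
rewrite E; move: pos; congr (0 < _).
rewrite (mulrCA y _ w0) (mulrCA y _ w1') d0 d1; ring.
Qed.

End Weingarten.
End MaximumPrinciple.

(** * The height estimate *)

Section CompactGraph.
Variables (R : realType) (Omega : set 'rV[R]_2) (u : 'rV[R]_2 -> R).
Hypotheses (G : compact_graph Omega u)
  (B : surface_boundary Omega u `<=` [set x | height x = 0]).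

Let oO : open Omega. Proof. by case: G => -[]. Qed.
Let OH : Omega `<=` @H2 R. Proof. by case: G => -[]. Qed.
Let Cu : smooth_on Omega u. Proof. by case: G. Qed.

Lemma superlevel_subset (e : R) p : 0 < e -> H2_closure Omega p -> e <= u p ->
  Omega p.
Proof.
move=> e0 Hp ep; apply: contrapT => nOp.
have : surface_boundary Omega u (graph_map u p) by exists p.
by move=> /B; rewrite /= /height graph_map2 => u0; lra.
Qed.

(** Compactness is assumed of the surface in space, so the set is obtained as the projection of a
    closed part of the surface. *)
Lemma superlevel_compact (e : R) :
  compact [set p | H2_closure Omega p /\ e <= u p].
Proof.
have -> : [set p | H2_closure Omega p /\ e <= u p] =
    (fun x : 'rV[R]_3 => lsubmx (x : 'rV[R]_(2 + 1))) @`
      (surface Omega u `&` [set x : 'rV[R]_3 | e <= x 0 2]).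
  apply/seteqP; split=> [p [Hp ep]|_ [_ [[p Hp <-] +] <-]].
    exists (graph_map u p); last exact: row_mxKl.
    by split; [exists p|rewrite /= graph_map2].
  by rewrite /= graph_map2 [lsubmx _]row_mxKl.
apply: continuous_compact.
  exact/continuous_subspaceT/(@continuous_lsubmx R 1 2 1).
apply: compact_closedI; first by case: G.
apply: (@closed_comp _ _ (fun x : 'rV[R]_3 => x 0 2) [set r | e <= r]).
  by move=> x _; exact: coord_continuous.
exact: closed_ge.
Qed.

(** A positive superlevel set is compact and avoids the boundary, where u = 0. So f may involve the
    slope, which is controlled only over [Omega]. *)
Lemma superlevel_max (e : R) (f : 'rV[R]_2 -> R) p0 : 0 < e ->
  H2_closure Omega p0 -> e <= u p0 ->
  (forall p, Omega p -> {for p, continuous f}) ->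
  exists p1, [/\ Omega p1, e <= u p1, f p0 <= f p1 &
    forall p, Omega p -> e <= u p -> f p <= f p1].
Proof.
move=> e0 H0 ep0 cf.
pose K := [set p | H2_closure Omega p /\ e <= u p].
have KO p : K p -> Omega p by move=> [? ?]; exact: superlevel_subset e0 _ _.
have [||c] := @compact_EVT_max _ R f K _ (@superlevel_compact e).
- by exists p0.
- apply: continuous_in_subspaceT => p; rewrite inE => /KO Op; exact: cf.
rewrite inE => Kc mx; exists c; split.
- exact: KO.
- by case: Kc.
- by apply: mx; rewrite inE.
- move=> p Op ep; apply: mx; rewrite inE; split => //; split; last exact: OH.
  exact: subset_closure.
Qed.

Section Weingarten.
Variables (a b c : R).
Hypotheses (b0 : 0 < b) (ab0 : 0 < a + b) (c0 : 0 < c).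
Hypothesis W : W_surface a b c Omega u.
Hypothesis Ke0 : forall p, Omega p -> 0 < graph_Ke u p.

Let hess_det_gt0 p : Omega p -> 0 < hess_det u p.
Proof.
move=> Op; rewrite (hess_detE oO OH Cu Op) mulr_gt0//; last exact: Ke0.
by rewrite exprn_gt0// slope_gt0.
Qed.

(** With a positive determinant, the sign of this one entry decides whether Hess u is positive or
    negative definite; it is the only entry tracked below. *)
Let hess00_neq0 p : Omega p -> hess u 0 0 p != 0.
Proof.
move=> /hess_det_gt0; apply: contraTneq => h0; rewrite /hess_det h0 mul0r.
by rewrite -leNgt sub0r mulrN oppr_le0 mulr_ge0// ?sqr_ge0// exprn_even_ge0.
Qed.

Lemma top_point p0 : H2_closure Omega p0 -> 0 < u p0 ->
  0 < c / (a + b) + a / (a + b) /\ exists2 p, Omega p & hess u 0 0 p < 0.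
Proof.
move=> H0 u0.
have [p [Op ep _ mx]] := superlevel_max u0 H0 (lexx _)
  (fun p Op => smooth_on_continuous Cu Op).
have loc : \forall q \near p, u q <= u p.
  apply: filterS (open_nbhs_nbhs (conj oO Op)) => q Oq.
  case: (leP (u p0) (u q)) => [/(mx _ Oq)//|/ltW uq].
  exact: le_trans ep.
have [crit quad] := smooth_on_local_max oO Cu Op loc.
have w1 : slope u p = 1 by rewrite /slope !crit !expr0n /= addr0 mulr0 addr0.
have := hess_det_gt0 Op.
rewrite (W_hess_det oO OH Cu ab0 W Op) w1 mul1r mulr1 => D0; split => //.
exists p => //; rewrite lt_neqAle hess00_neq0//= /hess ord2E crit mulr0 mul0r addr0.
have := quad 1 0; move: (partial _ _ p) (partial _ _ p) (partial _ _ p).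
by move=> r s v; lra.
Qed.

Lemma hess00_lt0 p q : Omega p -> hess u 0 0 p < 0 -> Omega q ->
  hess u 0 0 q < 0.
Proof.
move=> Op hp Oq.
(* The factor y > 0 keeps the sign of [hess u 0 0] and removes its division, so smoothness follows
   from sums and products. By connectedness a change of sign would force a zero. *)
pose g (q : 'rV[R]_2) : R := q 0 1 * partial 0 (partial 0 u) q - partial 1 u q.
have gE (r : 'rV[R]_2) : Omega r -> g r = r 0 1 * hess u 0 0 r.
  move=> Or; have y0 := H2_neq0 OH Or; rewrite /g /hess ord2E /=.
  by gen_partials; move: (r 0 1) y0 => y y0; field.
have Sg : smooth_on Omega g.
  apply: smooth_onD => //.
    apply: smooth_onM => //; first exact: smooth_on_coord.
    exact/smooth_on_partial/smooth_on_partial.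
  rewrite (_ : (fun x => _) = (fun x => -1 * partial 1 u x)).
    apply: smooth_onM => //; first exact: smooth_on_cst.
    exact: smooth_on_partial.
  by apply/funext => x; rewrite mulN1r.
have cO : connected Omega by case: G => -[].
have gO : is_interval (g @` Omega).
  apply/connected_intervalP/connected_continuous_connected => //.
  apply: continuous_in_subspaceT => x; rewrite inE => Ox.
  exact: smooth_on_continuous Sg Ox.
rewrite ltNge; apply/negP => hq.
have [r Or gr] : (g @` Omega) 0.
  apply: (gO (g p) (g q)); [by exists p|by exists q|].
  rewrite !gE//; have := OH Op; have := OH Oq; rewrite /H2 /= => yq yp.
  by rewrite pmulr_rle0// ltW//= mulr_ge0// ltW.
have := hess00_neq0 Or; have := gE r Or; rewrite gr => /esym/eqP.
by rewrite mulf_eq0 (negPf (H2_neq0 OH Or)) /= => ->.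
Qed.

Lemma height_le p0 (m : R) : H2_closure Omega p0 ->
  m = Num.min (c / (a + b)) (c / (a + b) + a / (a + b)) ->
  u p0 <= Num.sqrt ((m + 4) / m ^+ 2).
Proof.
move=> H0 mE; rewrite leNgt; apply/negP; set C := Num.sqrt _ => uC.
have C0 : 0 <= C by exact: sqrtr_ge0.
have [albe [q Oq hq]] := top_point H0 (le_lt_trans C0 uC).
have m0 : 0 < m by rewrite mE lt_min divr_gt0.
have C2 : C ^+ 2 = (m + 4) / m ^+ 2.
  by rewrite sqr_sqrtr// divr_ge0 ?exprn_ge0// ?addr_ge0// ltW.
have {}C0 : 0 < C.
  by rewrite sqrtr_gt0 divr_gt0 ?exprn_gt0// addr_gt0.
have s0 p : 0 < Num.sqrt (slope u p) by rewrite sqrtr_gt0 slope_gt0.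
pose f p := u p - C / Num.sqrt (slope u p).
have cf p : Omega p -> {for p, continuous f}.
  move=> Op; apply: continuousB; first exact: smooth_on_continuous Cu Op.
  apply: continuousM; first exact: cst_continuous.
  apply: continuousV; first by rewrite gt_eqF.
  apply: continuous_comp; last exact: sqrt_continuous.
  exact: smooth_on_continuous (smooth_on_slope oO Cu) Op.
(* Since f >= u - C, the value of f at p0 is at least this level, which is positive by
   assumption. *)
have e0 : 0 < u p0 - C by rewrite subr_gt0.
have eu : u p0 - C <= u p0 by lra.
have [p [Op ep fp mx]] := superlevel_max e0 H0 eu cf.
have fC r : u r - C <= f r.
  rewrite lerD2l lerN2 ler_pdivrMr// ler_peMr ?(ltW C0)//.
  by rewrite -[leLHS]sqrtr1 ler_wsqrtr// slope_ge1.
(* Outside the superlevel set, f r <= u r < u p0 - C <= f p0, so the maximum found there is a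
   maximum over [Omega]. *)
have {}mx r : Omega r -> f r <= f p.
  move=> Or; case: (leP (u p0 - C) (u r)) => [/(mx _ Or)//|ur].
  apply: (le_trans _ fp); apply: le_trans (fC p0); apply: le_trans (ltW ur).
  by rewrite gerBl divr_ge0// ltW.
have UE : u p - f p = C / Num.sqrt (slope u p) by rewrite /f opprB addrC subrK.
have sq r : Num.sqrt (slope u r) ^+ 2 = slope u r.
  by rewrite sqr_sqrtr// ltW// slope_gt0.
have UK : (u p - f p) ^+ 2 * slope u p = C ^+ 2.
  rewrite UE -{2}sq; move: (Num.sqrt _) (s0 p) => v v0.
  by field; rewrite gt_eqF.
have fu : f p < u p by rewrite -subr_gt0 UE divr_gt0.
apply: (W_no_local_max oO OH Cu b0 ab0 W Op fu UK _ m0).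
- exact: hess00_lt0 Oq hq Op.
- by rewrite mE ge_min lexx.
- by rewrite mE ge_min lexx orbT.
(* Here m^2 C^2 = m + 4, which leaves room above the strict bound m + 3. *)
- by rewrite C2 mulrC divfK ?expf_neq0 ?gt_eqF//; lra.
(* Near p the difference u r - f p stays positive, so the inequality u r - f p <= C / sqrt w can be
   squared; this passes from the maximum of f to the local maximum of [test_fun]. *)
have near_gt : \forall r \near p, f p < u r.
  have d0 : 0 < u p - f p by rewrite subr_gt0.
  apply: filterS (near_dist_lt (smooth_on_continuous Cu Op) d0) => r.
  by rewrite ltr_distlC => /andP[+ _]; rewrite opprB addrC subrK.
apply: filterS2 near_gt (open_nbhs_nbhs (conj oO Op)) => r fr Or.
rewrite /test_fun UK.
have : u r - f p <= C / Num.sqrt (slope u r).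
  by rewrite lerBlDr -lerBlDl; exact: mx.
rewrite ler_pdivlMr// => H; rewrite -(sq r) -exprMn ler_pXn2r// nnegrE; last exact: ltW.
by rewrite mulr_ge0// ltW// subr_gt0.
Qed.

End Weingarten.
End CompactGraph.

Theorem theorem4p7 (R : realType) :
  exists C0 : set R -> R -> R -> R -> R,
  forall (a b c : R) (Omega : set 'rV[R]_2) (u : 'rV[R]_2 -> R),
    a != 0 -> 0 < b -> 2 * a + b != 0 -> 0 < a + b -> 0 < c ->
    compact_graph Omega u ->
    surface_boundary Omega u `<=` [set x | height x = 0] ->
    W_surface a b c Omega u ->
    (forall p, Omega p -> 0 < graph_Ke u p) ->
    forall x, surface Omega u x ->
      height x <= C0 (graph_Ke u @` Omega) a b c.
Proof.
pose m (a b c : R) := Num.min (c / (a + b)) (c / (a + b) + a / (a + b)).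
exists (fun _ a b c => Num.sqrt ((m a b c + 4) / m a b c ^+ 2)).
move=> a b c Omega u _ b0 _ ab0 c0 G B W Ke0 _ [p Hp <-].
by rewrite /height graph_map2; exact: (height_le G B b0 ab0 c0 W Ke0 Hp).
Qed.
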